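(* Let $\Gamma$ be a finitely generated amenable group and $K$ a field. Then the group algebra $K\Gamma$ embeds (via an injective unital ring homomorphism) into the rank completion $\overline{\mathcal{A}}$ of some ultramatricial algebra $\mathcal{A}$ over $K$ equipped with a rank function arising from a harmonic function on its Bratteli diagram.
   Context: An ultramatricial algebra over $K$ is constructed as follows. For each $n\ge1$ take a finite product $\mathcal{A}_n=\bigoplus_{l=1}^{i_n}\mathrm{Mat}_{d^n_l\times d^n_l}(K)$ and nonnegative integers $K(l,j)=K_n(l,j)$ with $d^{n+1}_j=\sum_{l=1}^{i_n}d^n_l K_n(l,j)$ for all $j$. Let $\phi_n:\mathcal{A}_n\to\mathcal{A}_{n+1}$ be the injective map whose $j$-th component is a block diagonal embedding placing $K_n(l,j)$ copies of the $l$-th factor along the diagonal of $\mathrm{Mat}_{d^{n+1}_j\times d^{n+1}_j}(K)$. The ultramatricial algebra is the direct limit $\mathcal{A}=\varinjlim(\mathcal{A}_n,\phi_n)$. A harmonic function consists of reals $P(d^n_l)\ge0$ with $\sum_l P(d^n_l)=1$ and $P(d^n_l)=\sum_j \frac{d^n_lK_n(l,j)}{d^{n+1}_j}P(d^{n+1}_j)$. It defines a rank on $\mathcal{A}$ by $\mathrm{rk}(a_1\oplus\dots\oplus a_{i_n})=\sum_l P(d^n_l)\,\mathrm{rank}(a_l)/d^n_l$ (compatible with the $\phi_n$). The rank completion $\overline{\mathcal{A}}$ is the completion of $\mathcal{A}$ with respect to the metric $d(x,y)=\mathrm{rk}(x-y)$; it is again a regular ring with a rank function. *)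

(* Defs.v *)
From HB Require Import structures.
From mathcomp Require Import all_boot all_order all_algebra.
From mathcomp Require Import finmap.
From mathcomp Require Import Rstruct.
From Stdlib Require Rdefinitions.
Notation R := Rdefinitions.R.

Set Implicit Arguments.
Unset Strict Implicit.
Unset Printing Implicit Defensive.

Import Order.TTheory GRing.Theory Num.Theory.
Local Open Scope ring_scope.

Section GroupNotions.
Variable G : groupType.

Inductive gen_by (s : seq G) : G -> Prop :=
  | gen_by_one : gen_by s 1%g
  | gen_by_mul x y : gen_by s x -> y \in s -> gen_by s (x * y)%g
  | gen_by_mulV x y : gen_by s x -> y \in s -> gen_by s (x * y^-1)%g.

Definition finitely_generated : Prop :=
  exists s : seq G, forall g : G, gen_by s g.

Definition amenable : Prop :=
  exists mu : (G -> Prop) -> R,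
    [/\ mu (fun _ => True) = 1,
        forall A, 0 <= mu A,
        forall A B, (forall x, ~ (A x /\ B x)) ->
                    mu (fun x => A x \/ B x) = mu A + mu B
      & forall (g : G) A, mu (fun x => A (g^-1 * x)%g) = mu A].

Variable K : fieldType.

Definition galg := {fsfun G -> K with 0}.

Definition galg_add (x y : galg) : galg :=
  [fsfun g in (finsupp x `|` finsupp y)%fset => x g + y g | 0].

Definition galg_mul (x y : galg) : galg :=
  [fsfun g in [fset (h * k)%g | h in finsupp x, k in finsupp y]%fset =>
      \sum_(h <- finsupp x) x h * y (h^-1 * g)%g | 0].

Definition galg_one : galg := [fsfun g in [fset 1%g]%fset => 1 | 0].

End GroupNotions.

(* Ultramatricial algebras.  Levels are indexed by n : nat starting at 0.    *)
(*   i n       = number of matrix factors at level n                         *)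
(*   d n l     = size d^n_l of the l-th factor (l < i n)                     *)
(*   Kc n l j  = multiplicity K_n(l,j)                                       *)

Section Ultramatricial.
Variable K : fieldType.
Variables (i : nat -> nat) (d : nat -> nat -> nat) (Kc : nat -> nat -> nat -> nat).

Definition ualg (n : nat) := forall l : 'I_(i n), 'M[K]_(d n l).

Definition ua_add n (a b : ualg n) : ualg n := fun l => a l + b l.
Definition ua_mul n (a b : ualg n) : ualg n := fun l => a l *m b l.
Definition ua_one n : ualg n := fun l => 1%:M.

Definition mxget p (m : 'M[K]_p) (r s : nat) : K :=
  match insub r, insub s with
  | Some r', Some s' => m r' s'
  | _, _ => 0
  end.

(* offset, inside the j-th factor of level n+1, of the c-th copy of the
   l-th factor of level n (blocks ordered by l, then by copy c) *)
Definition blk_off n (l c j : nat) : nat :=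
  (\sum_(l' < l) d n l' * Kc n l' j + c * d n l)%N.

Definition phi_entry n (a : ualg n) (j : nat) (r s : nat) : K :=
  \sum_(l < i n) \sum_(c < Kc n l j)
     let o := blk_off n l c j in
     if (o <= r < o + d n l)%N && (o <= s < o + d n l)%N
     then mxget (a l) (r - o) (s - o) else 0.

Definition ua_phi n (a : ualg n) : ualg n.+1 :=
  fun j => \matrix_(r, s) phi_entry a j r s.

Definition ultramatricial_data : Prop :=
  [/\ forall n l, (l < i n)%N -> (0 < d n l)%N,
      forall n j, (j < i n.+1)%N -> d n.+1 j = (\sum_(l < i n) d n l * Kc n l j)%N
    & forall n, injective (@ua_phi n)].

Definition harmonic (P : nat -> nat -> R) : Prop :=
  [/\ forall n l, (l < i n)%N -> 0 <= P n l,
      forall n, \sum_(l < i n) P n l = 1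
    & forall n l, (l < i n)%N ->
        P n l = \sum_(j < i n.+1)
                  (d n l * Kc n l j)%:R / (d n.+1 j)%:R * P n.+1 j].

Definition ua_rank (P : nat -> nat -> R) n (a : ualg n) : R :=
  \sum_(l < i n) P n l * (\rank (a l))%:R / (d n l)%:R.

(* rank function (Goodearl) on a ring, together with subadditivity, so that
   d(x,y) = rk(x - y) is a metric *)
Definition rank_function (Rb : nzRingType) (rk : Rb -> R) : Prop :=
  [/\ rk 1 = 1,
      forall x y, rk (x * y) <= rk x /\ rk (x * y) <= rk y,
      forall e f, e * e = e -> f * f = f -> e * f = 0 -> f * e = 0 ->
                  rk (e + f) = rk e + rk f,
      forall x, x != 0 -> 0 < rk x
    & forall x y, rk (x + y) <= rk x + rk y].

(* (Rb, rk) is the rank completion of A = lim (A_n, phi_n) w.r.t. the rank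
   induced by P, realized through the canonical maps iota n : A_n -> Rb:
   these are unital ring maps compatible with the phi_n and preserving
   the rank, Rb is complete for d(x,y) = rk(x - y), and the image of A is
   dense.  This characterizes the metric completion up to isomorphism. *)
Definition is_rank_completion (P : nat -> nat -> R)
    (Rb : nzRingType) (rk : Rb -> R) (iota : forall n, ualg n -> Rb) : Prop :=
  rank_function rk /\
  [/\ forall n (a b : ualg n),
        [/\ iota n (ua_add a b) = iota n a + iota n b,
            iota n (ua_mul a b) = iota n a * iota n b
          & iota n (@ua_one n) = 1],
      forall n (a : ualg n), iota n.+1 (ua_phi a) = iota n a,
      forall n (a : ualg n), rk (iota n a) = ua_rank P a,
      (forall u : nat -> Rb,
         (forall eps : R, 0 < eps -> exists N, forall m k, (N <= m)%N -> (N <= k)%N ->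
              rk (u m - u k) < eps) ->
         exists x, forall eps : R, 0 < eps -> exists N, forall m, (N <= m)%N ->
              rk (u m - x) < eps)
    & forall (x : Rb) (eps : R), 0 < eps ->
         exists n (a : ualg n), rk (x - iota n a) < eps].

End Ultramatricial.

(* Main.v *)
Require Import Defs.
From HB Require Import structures.
From mathcomp Require Import all_boot all_order all_fingroup all_algebra.
From mathcomp Require Import finmap.
From mathcomp Require Import Rstruct.
From mathcomp Require Import boolp.
From mathcomp Require filter.
From mathcomp Require Import ring lra zify.
From Stdlib Require Rseries Rcomplete.

(* The group acts on itself by left translations, preserving the mean mu.
   Doubling is excluded by Hall's theorem, so G has Folner sets F.  Colour G with
   finitely many colours so that nearby points differ, and order the colours at
   random; sending x to the element of F^-1 x whose colour comes first partitions
   G into pieces of finitely many shapes, and a given generator rarely leaves a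
   piece.  Only finitely many orders are involved, so a finitely additive mu
   suffices to choose a good one.  Iterating on the pieces already built gives
   coarser and coarser partitions.  Shapes are the vertices of a Bratteli
   diagram, inclusions of tiles its edges, and the mean of the set of points
   lying in tiles of a given shape is a harmonic function.  Compressing left
   multiplication by x in KG to the tiles of level n gives a matrix a_n(x) for
   which phi(a_n(x)) - a_(n+1)(x) and a_n(x) a_n(y) - a_n(xy) have nonzero columns
   only at points that some element of a fixed finite set moves out of their tile;
   the rank of these defects is thus small and a_n(x) converges.  The limit is
   nonzero for x <> 0: almost all columns of a_n(x) are nonzero while every row
   and column has at most |supp x| nonzero entries, so the normalized rank of
   a_n(x) stays above about 1/|supp x|^2. *)

Set Implicit Arguments.
Unset Strict Implicit.
Unset Printing Implicit Defensive.

Import Order.TTheory GRing.Theory Num.Theory.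
Local Open Scope ring_scope.

(** * Invariant means *)

(** The two sides of the group play different roles. Tiles are right translates [shp * org] of their
    shapes, while left multiplication by [x] has the entry [x (w * z^-1)] at the points [w], [z];
    the origin cancels, so all tiles of one shape carry the same matrix and one finite algebra
    describes a whole level. The mean is invariant on the left, and a left translation carries one
    position of a shape to any other, so all positions of a shape have equal mean. Hence a number of
    columns divided by the size of the matrix becomes a mean of points, on which all rank estimates
    rest. As [mu] is only finitely additive, there is no exhaustion argument that could absorb an
    exceptional set: each level has to be an exact partition obtained from finitely many choices. A
    coarse shape must also remember how it is cut into finer tiles; otherwise the multiplicities of
    the Bratteli diagram could differ between tiles of the same shape. *)

Section Mean.
Variables (G : groupType) (mu : (G -> Prop) -> R).

Definition invariant_mean : Prop :=
  [/\ mu (fun _ => True) = 1,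
      forall A, 0 <= mu A,
      forall A B, (forall x, ~ (A x /\ B x)) ->
                  mu (fun x => A x \/ B x) = mu A + mu B
    & forall (g : G) A, mu (fun x => A (g^-1 * x)%g) = mu A].

Hypothesis mu_mean : invariant_mean.

Lemma mean_ext (A B : G -> Prop) : (forall x, A x <-> B x) -> mu A = mu B.
Proof. by move=> AB; congr mu; apply: funext => x; apply: propext. Qed.

Lemma mean_ge0 A : 0 <= mu A.
Proof. by case: mu_mean => _ /(_ A). Qed.

Lemma mean_setT : mu (fun _ => True) = 1.
Proof. by case: mu_mean. Qed.

Lemma meanU A B : (forall x, ~ (A x /\ B x)) ->
  mu (fun x => A x \/ B x) = mu A + mu B.
Proof. by case: mu_mean => _ _ /(_ A B). Qed.

Lemma mean_split (B A : G -> Prop) :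
  mu A = mu (fun x => A x /\ B x) + mu (fun x => A x /\ ~ B x).
Proof.
rewrite -meanU; last by move=> x; tauto.
by apply: mean_ext => x; have := EM (B x); tauto.
Qed.

Lemma mean_set0 A : (forall x, ~ A x) -> mu A = 0.
Proof.
move=> A0; have := @meanU A A; rewrite (mean_ext (B := A)); last by move=> x; tauto.
by move=> /(_ _) h; have /h : forall x, ~ (A x /\ A x) by [move=> x [/A0]]; lra.
Qed.

Lemma mean_translate (g : G) A : mu (fun x => A (g * x)%g) = mu A.
Proof.
case: mu_mean => _ _ _ /(_ (g^-1)%g A) <-.
by apply: mean_ext => x; rewrite invgK.
Qed.

Lemma mean_le A B : (forall x, A x -> B x) -> mu A <= mu B.
Proof.
move=> AB; rewrite (mean_split A B) (mean_ext (B := A)); last by move=> x; split; [case|move=> h; split; auto].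
by rewrite lerDl mean_ge0.
Qed.

Lemma mean_le1 A : mu A <= 1.
Proof. by rewrite -mean_setT; apply: mean_le. Qed.

Lemma mean_sum_disjoint (I : finType) (A : I -> G -> Prop) (B : G -> Prop) :
    (forall x, B x <-> exists i, A i x) ->
    (forall i j x, A i x -> A j x -> i = j) ->
  mu B = \sum_i mu (A i).
Proof.
move=> BA dis.
suff H (s : seq I) : uniq s -> mu (fun x => exists2 i, i \in s & A i x) = \sum_(i <- s) mu (A i).
  rewrite -big_enum -H ?enum_uniq //; apply: mean_ext => x; rewrite BA.
  by split=> [[i]|[i _]]; exists i => //; rewrite mem_enum.
elim: s => [|a s IHs] /=; first by rewrite big_nil mean_set0 // => x [].
case/andP=> as_ us; rewrite big_cons -IHs // -meanU.
  apply: mean_ext => x; split=> [[i]|[Aa|[i si Ai]]].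
  - by rewrite inE => /predU1P[->|si Ai]; [left|right; exists i].
  - by exists a => //; rewrite mem_head.
  - by exists i => //; rewrite inE si orbT.
by move=> x [Aa [i si Ai]]; move: as_; rewrite (dis _ _ _ Aa Ai) si.
Qed.

(* Counting form of Markov's inequality; only finite additivity is available,
   so the space is cut along the finitely many patterns [fun i => A i x]. *)
Lemma mean_sum_overlap (I : finType) (A : I -> G -> Prop) (k : nat) :
    (forall x, (#|[set i | `[< A i x >]]| <= k)%N) ->
  \sum_i mu (A i) <= k%:R.
Proof.
move=> Ak; pose pat x : {set I} := [set i | `[< A i x >]].
have -> : \sum_i mu (A i) = \sum_i \sum_(J : {set I} | i \in J) mu (fun x => pat x = J).
  apply: eq_bigr => i _; rewrite big_mkcond /=.
  rewrite (@mean_sum_disjoint _ (fun J x => pat x = J /\ A i x) (A i)).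
  - apply: eq_bigr => J _; case: ifP => iJ.
      apply: mean_ext => x; split=> [[]//|px]; split=> //.
      by move: iJ; rewrite -px inE => /asboolP.
    by apply: mean_set0 => x [px Ai]; move: iJ; rewrite -px inE; case: asboolP.
  - by move=> x; split=> [Ai|[J []//]]; exists (pat x).
  - by move=> J J' x [<- _] [<-].
rewrite (exchange_big_dep predT) //=.
apply: (@le_trans _ _ (\sum_(J : {set I}) mu (fun x => pat x = J) * k%:R)).
  apply: ler_sum => J _; rewrite sumr_const.
  case: (EM (exists x, pat x = J)) => [[x px]|nx].
    rewrite -[leLHS]mulr_natr ler_wpM2l ?mean_ge0 // ler_nat.
    by rewrite -px (leq_trans _ (Ak x)) // subset_leq_card //; apply/subsetP.
  by rewrite mean_set0 ?mul0rn ?mul0r // => x px; apply: nx; exists x.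
rewrite -mulr_suml -[leRHS]mul1r ler_wpM2r ?ler0n //.
rewrite -(@mean_sum_disjoint _ (fun J x => pat x = J) (fun=> True)) ?mean_le1 //.
  by move=> x; split=> // _; exists (pat x).
by move=> i j x <- <-.
Qed.

Lemma mean_union_le (T : eqType) (s : seq T) (A : T -> G -> Prop) (c : R) (B : G -> Prop) :
    (forall t, t \in s -> mu (A t) <= c) ->
    (forall x, B x -> exists2 t, t \in s & A t x) ->
  mu B <= (size s)%:R * c.
Proof.
elim: s B => [|a s IHs] B Ac BA /=.
  by rewrite mul0r mean_set0 // => x /BA[].
rewrite (mean_split (A a) B) -natr1 mulrDl mul1r [leRHS]addrC lerD //.
  by apply: le_trans (Ac a (mem_head _ _)); apply: mean_le => x [].
apply: IHs => [t ts|x [/BA[t]]]; first by apply: Ac; rewrite inE ts orbT.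
by rewrite inE => /predU1P[->|ts] At nA //; exists t.
Qed.

End Mean.

(** * Folner sets *)

(* Rado's proof: as long as some [N x] has two elements, one of them can be
   dropped without destroying Hall's condition. *)
Lemma hall_marriage (I : finType) (T : choiceType) (N : I -> {fset T}) :
    (forall A : {set I}, (#|A| <= #|` \bigcup_(i <- enum A) N i|%fset)%N) ->
  exists f : I -> T, injective f /\ forall i, f i \in N i.
Proof.
have [n] := ubnP (\sum_i #|` N i|)%N; elim: n N => // n IHn N leN hallN.
have mem_cup (M : I -> {fset T}) (A : {set I}) y :
    reflect (exists2 i, i \in A & y \in M i) (y \in \bigcup_(i <- enum A) M i)%fset.
  apply: (iffP (bigfcupP _ _ _ _)) => [[i]|[i iA yi]].
    by rewrite mem_enum andbT; exists i.
  by exists i => //; rewrite mem_enum andbT.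
have N0 i : exists y, y \in N i.
  have := hallN [set i]; rewrite cards1 cardfs_gt0 => /fset0Pn[y /mem_cup[j]].
  by rewrite inE => /eqP-> yi; exists y.
case: (EM (exists x y1 y2, [/\ y1 != y2, y1 \in N x & y2 \in N x])); last first.
  (* Every [N i] is a singleton here, and Hall's condition on pairs makes them distinct. *)
  move=> uniqN; have /choice[f fN] := N0; exists f; split=> // i j fij.
  apply/eqP/contraT => nij; have := hallN [set i; j].
  rewrite cards2 nij leqNgt => /negP[]; rewrite ltnS /= -(cardfs1 (f i)).
  apply: fsubset_leq_card; apply/fsubsetP => y /mem_cup[k].
  rewrite !inE => kij yk; apply/contraT => yfi; case: uniqN.
  exists k, y, (f i); split=> //.
  by case/orP: kij => /eqP->; rewrite // fij.
case=> x [y1 [y2 [y12 y1x y2x]]].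
pose N' y i := (if i == x then N i `\ y else N i)%fset.
have N'sub y i : (N' y i `<=` N i)%fset.
  by rewrite /N'; case: ifP => // _; exact: fsubD1set.
have step y : y \in N x ->
    (forall A : {set I}, (#|A| <= #|` \bigcup_(i <- enum A) N' y i|%fset)%N) ->
  exists f : I -> T, injective f /\ forall i, f i \in N i.
  move=> yx hallN'; case: (IHn (N' y)) => //.
    apply: leq_trans (ltnSE leN); rewrite (bigD1 x) //= [X in (_ < X)%N](bigD1 x) //=.
    rewrite /N' eqxx [X in (_ < X + _)%N](cardfsD1 y) yx addSn ltnS leq_add2l.
    by apply: leq_sum => i /negPf->.
  by move=> f [finj fN']; exists f; split=> // i; apply: (fsubsetP (N'sub y i)).
have bad y : y \in N x ->
    ~ (forall A : {set I}, (#|A| <= #|` \bigcup_(i <- enum A) N' y i|%fset)%N) ->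
  exists2 A : {set I}, x \in A & (#|` \bigcup_(i <- enum A) N' y i|%fset < #|A|)%N.
  move=> yx /existsNP[A /negP]; rewrite -ltnNge => ltA; exists A => //.
  apply/contraT => xA; have := hallN A; rewrite leqNgt => /negP[].
  apply: leq_ltn_trans ltA; apply: fsubset_leq_card; apply/fsubsetP => t /mem_cup[i iA ti].
  by apply/mem_cup; exists i => //; rewrite /N'; case: eqP iA xA => // -> ->.
have [/step|/bad] := EM (forall A : {set I}, (#|A| <= #|` \bigcup_(i <- enum A) N' y1 i|%fset)%N).
  exact.
move=> /(_ y1x)[A xA ltA].
have [/step|/bad] := EM (forall A : {set I}, (#|A| <= #|` \bigcup_(i <- enum A) N' y2 i|%fset)%N).
  exact.
move=> /(_ y2x)[B xB ltB].
set P := (\bigcup_(i <- enum A) _)%fset in ltA.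
set Q := (\bigcup_(i <- enum B) _)%fset in ltB.
(* Both violating sets contain [x]. A neighbour of [x] differs from [y1] or from [y2], so [P] and
   [Q] together still contain all neighbours of the union. Adding Hall's inequalities for [A :|: B]
   and [(A :&: B) :\ x] gives |A| + |B| - 1 <= |P| + |Q|, while the violations give |P| + |Q| <= |A|
   + |B| - 2. *)
have : (#|A :|: B| <= #|` (P `|` Q)%fset|)%N.
  apply: leq_trans (hallN _) _; apply: fsubset_leq_card; apply/fsubsetP => t /mem_cup[i].
  rewrite !inE; case: (i =P x) => [->|/eqP/negPf ix].
    move=> _ tx; case: (t =P y1) => [->|/eqP ty].
      by apply/orP; right; apply/mem_cup; exists x => //; rewrite /N' eqxx !inE y12.
    by apply/orP; left; apply/mem_cup; exists x => //; rewrite /N' eqxx !inE ty.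
  by case/orP=> iAB ti; apply/orP; [left|right]; apply/mem_cup; exists i; rewrite // /N' ix.
have : (#|(A :&: B) :\ x| <= #|` (P `&` Q)%fset|)%N.
  apply: leq_trans (hallN _) _; apply: fsubset_leq_card; apply/fsubsetP => t /mem_cup[i].
  rewrite !inE => /and3P[/negPf ix iA iB] ti.
  by apply/andP; split; apply/mem_cup; exists i; rewrite // /N' ix.
have := cardfsUI P Q; have := cardsUI A B; have := cardsD1 x (A :&: B).
rewrite inE xA xB /= => *; exfalso; lia.
Qed.

(** A free ultrafilter does the work of compactness: it turns matchings of larger and larger finite
    sets into one matching of the whole group. *)
Lemma ultrafilter_nat : exists U : (nat -> Prop) -> Prop,
  [/\ forall A B : nat -> Prop, (forall n, A n -> B n) -> U A -> U B,
      forall A B : nat -> Prop, U A -> U B -> U (fun n => A n /\ B n),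
      forall A : nat -> Prop, U A \/ U (fun n => ~ A n),
      forall A, U A -> exists n, A n
    & forall N, U (fun n => (N <= n)%N)].
Proof.
have [U [ultraU subU]] := filter.ultraFilterLemma filter.eventually_filter.
exists U; split.
- by move=> A B AB; exact: filter.filterS.
- by move=> A B; exact: filter.filterI.
- by move=> A; exact: filter.in_ultra_setVsetC.
- by move=> A UA; have [n] := filter.filter_ex UA; exists n.
- by move=> N; apply: subU; exists N.
Qed.

Section Folner.
Local Open Scope fset_scope.
Variables (G : groupType) (e : nat -> G).
Hypothesis e_surj : forall g, exists n, e n = g.
Variables (mu : (G -> Prop) -> R).
Hypothesis mu_mean : invariant_mean mu.

Definition fset_mulg (S F : {fset G}) : {fset G} := [fset (s * x)%g | s in S, x in F].

Lemma mem_fset_mulg S F y :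
  reflect (exists s x, [/\ s \in S, x \in F & y = (s * x)%g]) (y \in fset_mulg S F).
Proof.
apply: (iffP (imfset2P _ _ _ _ _)) => /= [[s sS [x xF ->]]|[s [x [sS xF ->]]]].
  by exists s, x.
by exists s => //; exists x.
Qed.

(** Doubling gives an injection of two copies of [G] into [G] that moves each point by an element of
    [S], that is, a paradoxical decomposition. Cut according to the translating element, each copy
    keeps mean one, so disjoint sets would have total mean two. *)
Lemma not_doubling (S : {fset G}) :
  ~ forall F : {fset G}, (2 * #|` F| <= #|` fset_mulg S F|)%N.
Proof.
move=> dbl.
pose F n := [fset e k | k in iota 0 n].
have FP k n : (k < n)%N -> e k \in F n.
  by move=> kn; apply/imfsetP; exists k; rewrite //= mem_iota.
have [s0 s0S] : exists s0, s0 \in S.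
  have : (0 < #|` fset_mulg S [fset 1%g]|)%N by apply: leq_trans (dbl _); rewrite cardfs1.
  by rewrite cardfs_gt0 => /fset0Pn[y /mem_fset_mulg[s [x []]]]; exists s.
have /choice[h hP] n : exists h : G -> bool -> S, forall x x' b b',
    x \in F n -> x' \in F n -> (val (h x b) * x = val (h x' b') * x')%g -> x = x' /\ b = b'.
  (* Both copies of a point [x] may be matched to any point of [S x]; a set of pairs is at most
     twice as large as its first projection, so doubling is Hall's condition. *)
  pose N (p : F n * bool) := [fset (s * val p.1)%g | s in S].
  have [A|f [finj fN]] := @hall_marriage _ _ N.
    pose A2 := [set p.1 | p in A]%SET.
    pose A1 := [fset val x | x in A2].
    have cardA1 : #|` A1| = #|A2| by rewrite card_imfset //= -?cardE //; exact: val_inj.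
    apply: (@leq_trans (2 * #|` A1|)).
      rewrite cardA1 mulnC -card_bool -[#|{: bool}|]cardsT -cardsX.
      apply: subset_leq_card; apply/subsetP => -[x b] xA.
      by rewrite !inE /= andbT; apply/imsetP; exists (x, b).
    apply: (leq_trans (dbl A1)).
    apply: fsubset_leq_card; apply/fsubsetP => _ /mem_fset_mulg[s [x [sS /imfsetP[z /= zA ->] ->]]].
    case/imsetP: zA => p pA ->.
    apply/bigfcupP; exists p; first by rewrite mem_enum pA.
    by apply/imfsetP; exists s.
  have pickS x b : exists s : S, forall xF : x \in F n, f ([` xF], b) = (val s * x)%g.
    have [xF|xF] := EM (x \in F n); last by exists [` s0S] => xF'; case: (xF xF').
    have /imfsetP[s /= sS fs] := fN ([` xF], b).
    by exists [` sS] => xF'; rewrite (bool_irrelevance xF' xF) fs.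
  have [h hP] := choice (fun p : G * bool => pickS p.1 p.2).
  exists (fun x b => h (x, b)) => x x' b b' xF xF'.
  have := hP (x, b) xF; have := hP (x', b') xF' => /= <- <- /finj.
  by case.
have [U [US UI Uor Uex UN]] := ultrafilter_nat.
(* As [S] is finite, the translating element used for a given point and copy is constant along the
   ultrafilter. *)
have Ulim (I : finType) (u : nat -> I) : exists i, U (fun n => u n = i).
  apply: contrapT => nU.
  have : U (fun n => forall i, i \in enum I -> u n <> i).
    elim: (enum I) => [|i s IHs]; first by apply: US (UN 0%N).
    case: (Uor (fun n => u n = i)) => [Ui|Ui]; first by case: nU; exists i.
    by apply: US (UI _ _ Ui IHs) => n [ui us] j; rewrite inE => /predU1P[->|/us].
  by move=> /Uex[n /(_ (u n))]; rewrite mem_enum => /(_ isT).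
have [H HP] := choice (fun p : G * bool => Ulim _ (fun n => h n p.1 p.2)).
have Hinj x x' b b' : (val (H (x, b)) * x = val (H (x', b')) * x')%g -> x = x' /\ b = b'.
  move=> eqH; have [k ek] := e_surj x; have [k' ek'] := e_surj x'.
  have [n [kn [kn' [hx hx']]]] :=
    Uex _ (UI _ _ (UN k.+1) (UI _ _ (UN k'.+1) (UI _ _ (HP (x, b)) (HP (x', b'))))).
  by apply: (hP n); rewrite -?ek -?ek' ?FP // ek ek' hx hx'.
pose B (p : S * bool) y := exists x, H (x, p.2) = p.1 /\ y = (val p.1 * x)%g.
have muB p : mu (B p) = mu (fun x => H (x, p.2) = p.1).
  rewrite -(mean_translate mu_mean (val p.1)); apply: mean_ext => x; split.
    by case=> x' [Hx' /mulgI ->].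
  by move=> Hx; exists x.
have : (\sum_p mu (B p) <= 1)%R.
  rewrite -(@mean_sum_disjoint _ _ mu_mean _ B (fun x => exists p, B p x)) ?mean_le1 //.
  move=> [s b] [s' b'] y [x /= [Hx ->]] [x' /= [<-]]; rewrite -Hx.
  by case/Hinj=> -> ->.
rewrite -(pair_bigA _ (fun s b => mu (B (s, b)))) /= exchange_big /=.
under eq_bigr => b _.
  under eq_bigr do rewrite muB /=.
  rewrite -(@mean_sum_disjoint _ _ mu_mean _ (fun s x => H (x, b) = s) (fun=> True)) ?(mean_setT mu_mean).
  - over.
  - by move=> x; split=> // _; exists (H (x, b)).
  - by move=> i j x -> ->.
by rewrite sumr_const card_bool; lra.
Qed.

(** Without such an [F], multiplication by [S1] enlarges every finite set by the factor 1 + 1/m,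
    because [F] and the part of [s F] outside [F] are disjoint. After [m] rounds the factor is (1 +
    1/m)^m >= 2 by Bernoulli's inequality, and [m] rounds stay inside a product with one finite set
    [Sm], which would therefore be doubling. *)
Lemma folner_set (S : {fset G}) (m : nat) : (0 < m)%N -> exists F : {fset G},
  F != fset0 /\ forall s, s \in S -> (m * #|` [fset f in F | (s * f)%g \notin F]| <= #|` F|)%N.
Proof.
move=> m0; apply: contrapT => nF.
pose S1 := 1%g |` S; pose SF k F := iter k (fset_mulg S1) F.
have grow (F : {fset G}) : (m.+1 * #|` F| <= m * #|` fset_mulg S1 F|)%N.
  have [->|F0] := eqVneq F fset0; first by rewrite cardfs0 muln0.
  have [s [sS ltF]] : exists s, s \in S /\ (#|` F| < m * #|` [fset f in F | (s * f)%g \notin F]|)%N.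
    apply: contrapT => ns; apply: nF; exists F; split=> // s sS; rewrite leqNgt; apply/negP => lt.
    by apply: ns; exists s.
  rewrite mulSn addnC; apply: leq_trans (leq_add (leqnn _) (ltnW ltF)) _.
  rewrite -mulnDr leq_mul2l; apply/orP; right.
  set E := [fset f in F | _].
  have <- : #|` [fset (s * f)%g | f in E]| = #|` E| by rewrite card_imfset //=; exact: mulgI.
  rewrite -cardfsUI; have -> : F `&` [fset (s * f)%g | f in E] = fset0.
    apply/fsetP => y; rewrite !inE; apply/negP => /andP[yF /imfsetP[f /=]].
    by rewrite !inE => /andP[_ /negP nyF] yE; apply: nyF; rewrite -yE.
  rewrite cardfs0 addn0; apply: fsubset_leq_card; apply/fsubsetP => y.
  rewrite inE => /orP[yF|/imfsetP[f /=]].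
    by apply/mem_fset_mulg; exists 1%g, y; rewrite mul1g !inE eqxx.
  rewrite !inE => /andP[fF _] ->.
  by apply/mem_fset_mulg; exists s, f; rewrite !inE sS orbT.
have growk k F : (m.+1 ^ k * #|` F| <= m ^ k * #|` SF k F|)%N.
  elim: k => [|k IHk]; first by rewrite !mul1n.
  rewrite !expnS -!mulnA mulnCA [leqRHS]mulnCA /=.
  apply: (@leq_trans (m.+1 * (m ^ k * #|` SF k F|))); first by rewrite mulnCA leq_mul2l IHk orbT.
  by rewrite mulnCA leq_mul2l grow orbT.
have bern k : (m ^ k * (m + k) <= m.+1 ^ k * m)%N.
  elim: k => [|k IHk]; first by rewrite addn0.
  rewrite !expnS -!mulnA; apply: leq_trans (leq_mul (leqnn m.+1) IHk).
  by rewrite mulnCA [leqRHS]mulnCA leq_mul2l; apply/orP; right; nia.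
have powS k : exists Sk : {fset G}, forall F, SF k F `<=` fset_mulg Sk F.
  elim: k => [|k [Sk IHk]].
    exists [fset 1%g] => F; apply/fsubsetP => y yF.
    by apply/mem_fset_mulg; exists 1%g, y; rewrite mul1g inE.
  exists (fset_mulg S1 Sk) => F; apply/fsubsetP => _ /mem_fset_mulg[s [x [sS xF ->]]].
  have /mem_fset_mulg[t [z [tS zF ->]]] := fsubsetP (IHk F) _ xF.
  apply/mem_fset_mulg; exists (s * t)%g, z; rewrite mulgA; split=> //.
  by apply/mem_fset_mulg; exists s, t.
have [Sm SmP] := powS m; apply: (@not_doubling Sm) => F.
apply: leq_trans (fsubset_leq_card (SmP F)).
rewrite -(@leq_pmul2l (m ^ m * m)) ?muln_gt0 ?expn_gt0 ?m0 //.
have := leq_mul (bern m) (leqnn #|` F|); have := leq_mul (growk m F) (leqnn m); nia.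
Qed.

End Folner.

(** * Random partitions *)

Lemma card_le_cover (T : finType) (U : eqType) (s : seq U) (B : U -> {set T})
    (A : {set T}) (q k : nat) :
    (forall x, x \in A -> exists2 u, u \in s & x \in B u) ->
    (forall u, u \in s -> (q * #|B u| <= k)%N) ->
  (q * #|A| <= size s * k)%N.
Proof.
elim: s A => [|u s IHs] A AB Bk /=.
  have -> : A = set0 by apply/setP => x; rewrite inE; apply/negP => /AB[].
  by rewrite cards0 muln0.
rewrite -(cardsID (B u) A) mulnDr mulSn leq_add //.
  apply: leq_trans (Bk u (mem_head _ _)).
  by rewrite leq_mul2l subset_leq_card ?orbT // subsetIr.
apply: IHs => [x|v vs]; last by rewrite Bk // inE vs orbT.
rewrite inE => /andP[nBx /AB[v]]; rewrite inE => /predU1P[->|vs Bx]; last by exists v.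
by rewrite (negPf nBx).
Qed.

(* Among uniformly random priorities every element of [Q] is equally likely to
   come first. *)
Lemma card_perm_min (n : nat) (Q : {set 'I_n}) (a : 'I_n) : a \in Q ->
  (#|Q| * #|[set s : 'S_n | [forall b in Q, s a <= s b]]| <= n`!)%N.
Proof.
move=> aQ; pose M b := [set s : 'S_n | [forall c in Q, s b <= s c]%N].
have cardM b : b \in Q -> #|M b| = #|M a|.
  suff le x y : x \in Q -> y \in Q -> (#|M x| <= #|M y|)%N.
    by move=> bQ; apply/eqP; rewrite eqn_leq !le.
  (* Composing with the transposition exchanges the priorities of [x] and [y]. *)
  move=> xQ yQ; rewrite -(card_imset _ (mulgI (tperm x y))).
  apply: subset_leq_card; apply/subsetP => _ /imsetP[s sM ->].
  rewrite inE in sM; rewrite inE; apply/'forall_implyP => c cQ.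
  rewrite !permM tpermR; move/'forall_implyP: sM; apply.
  by case: tpermP.
have <- : (\sum_(b in Q) #|M b| = #|Q| * #|M a|)%N.
  by rewrite -sum_nat_const; apply: eq_bigr => b /cardM.
rewrite -card_Sn -sum1_card; under eq_bigr do rewrite -sum1_card.
rewrite (exchange_big_dep predT) //=; apply: leq_sum => s _.
rewrite sum1dep_card; apply/card_le1_eqP => b c; rewrite !inE.
move=> /andP[bQ /'forall_implyP bM] /andP[cQ /'forall_implyP cM].
by apply: (@perm_inj _ s); apply/val_inj/eqP; rewrite eqn_leq bM ?cM.
Qed.

Section Partition.
Local Open Scope fset_scope.
Variables (G : groupType) (e : nat -> G).
Hypothesis e_surj : forall g, exists n, e n = g.

(** Greedy colouring along the enumeration: a point has at most [N] neighbours [d * x], so one of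
    [N.+1] colours is free. [D] is made symmetric because either of two neighbours may be enumerated
    first. *)
Lemma separating_coloring (D : {fset G}) : exists (N : nat) (c : G -> 'I_N.+1),
  forall x y, x != y -> (y * x^-1)%g \in D -> c x != c y.
Proof.
have exD x : exists n, e n == x by have [n <-] := e_surj x; exists n.
pose idx x := ex_minn (exD x).
have eidx x : e (idx x) = x by rewrite /idx; case: ex_minnP => n /eqP.
pose D' := D `|` [fset x^-1%g | x in D].
pose N := #|` D'|.
have exfresh (f : G -> 'I_N.+1) x : exists i, forall d, d \in D' -> f (d * x)%g != i.
  pose Q := [set i | [exists d : D', f (val d * x)%g == i]].
  have : (#|Q| < N.+1)%N.
    rewrite ltnS; apply: (@leq_trans #|{: D'}|); last by rewrite /N cardfE.
    apply: leq_trans (leq_imset_card (fun d : D' => f (val d * x)%g) D').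
    apply: subset_leq_card; apply/subsetP => i; rewrite inE => /existsP[d /eqP <-].
    by apply: imset_f.
  rewrite ltnNge => /negP nQ; apply: contrapT => nex; apply: nQ.
  rewrite -[X in (X <= _)%N]card_ord; apply: subset_leq_card; apply/subsetP => i _; rewrite inE; apply: contrapT => ni.
  apply: nex; exists i => d dD; apply/eqP => fi; apply: ni.
  by apply/existsP; exists [` dD]; rewrite /= fi.
have [fresh freshP] := choice (fun p : (G -> 'I_N.+1) * G => exfresh p.1 p.2).
(* Stage [n] fixes the colour of the point of index [n]; points not yet reached carry the dummy
   colour [ord0]. The final colour of [x] is thus [C (idx x).+1 x]. *)
pose C := fix C n : G -> 'I_N.+1 := if n is m.+1 then
  fun x => if idx x == m then fresh (C m, x) else C m x else fun=> ord0.
have Cstable x n : (idx x < n)%N -> C n x = C (idx x).+1 x.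
  elim: n => // n IHn; rewrite ltnS leq_eqVlt => /predU1P[-> //|lt].
  by rewrite /= eqxx; case: eqP lt IHn => [<-|_ lt ->]; rewrite ?ltnn //= eqxx.
have lt_neq x y : (idx x < idx y)%N -> (x * y^-1)%g \in D' -> C (idx x).+1 x != C (idx y).+1 y.
  move=> lt xyD; rewrite [C (idx y).+1 y]/= eqxx -(Cstable x (idx y)) //.
  by have := freshP (C (idx y), y) _ xyD; rewrite /= mulgVK.
exists N, (fun x => C (idx x).+1 x) => x y nxy yxD.
have [lt|lt|eqi] := ltngtP (idx x) (idx y).
- apply: lt_neq => //; rewrite inE; apply/orP; right; apply/imfsetP.
  by exists (y * x^-1)%g; rewrite //= invMg invgK.
- by rewrite eq_sym; apply: lt_neq => //; rewrite inE yxD.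
- by move: nxy; rewrite -(eidx x) -(eidx y) eqi eqxx.
Qed.

Variables (mu : (G -> Prop) -> R).
Hypothesis mu_mean : invariant_mean mu.

(* [z x] is the element of [F^-1 x] whose colour has the highest priority.
   For a uniformly random priority, [z (s x) <> z x] only if the overall first
   element of [F^-1 x] and [F^-1 s x] lies in one of these sets but not both,
   which is unlikely when [F] is a Folner set. *)
Lemma small_boundary (S : {fset G}) (eps : R) : 0 < eps ->
  exists (F : {fset G}) (z : G -> G),
    (forall x, (x * (z x)^-1)%g \in F) /\
    forall s, s \in S -> mu (fun x => z (s * x)%g <> z x) < eps.
Proof.
move=> eps0.
pose S' := 1%g |` (S `|` [fset s^-1%g | s in S]).
(* At each point a fraction at most 2/m of the priorities will be bad for a given [s]; summed over
   [S] this must stay below [eps]. *)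
have [m m_gt] : exists m : nat, (2 * #|` S|)%:R < m%:R * eps.
  by exists (Num.Def.archi_bound ((2 * #|` S|)%:R / eps)); rewrite -ltr_pdivrMr // archi_boundP // divr_ge0 // ltW.
have m0 : (0 < m)%N by case: (m) m_gt => //; rewrite mul0r ltrn0.
have [F [F0 Ffol]] := @folner_set G e e_surj mu mu_mean S' m m0.
have /fset0Pn[f0 f0F] := F0.
pose near s x := [fset (f^-1 * x)%g | f in F] `|` [fset (f^-1 * s * x)%g | f in F].
(* [D1] contains [w * x^-1] for every [w] in [near s x], so [D] contains all quotients of two points
   of [near s x], and the colouring is injective there. *)
pose D1 := [fset (g^-1 * s)%g | g in F, s in S'].
pose D := fset_mulg D1 [fset g^-1%g | g in D1].
have [N [c cP]] := separating_coloring D.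
have nearD s x y y' : s \in S -> y \in near s x -> y' \in near s x -> c y = c y' -> y = y'.
  move=> sS; have nearD1 w : w \in near s x -> (w * x^-1)%g \in D1.
    rewrite inE => /orP[] /imfsetP[f /= fF ->]; rewrite mulgK; apply/imfset2P.
      by exists f => //; exists 1%g; rewrite ?mulg1 // !inE eqxx.
    by exists f => //; exists s; rewrite // !inE sS orbT.
  move=> /nearD1 yD /nearD1 yD' cyy'; apply/eqP/contraT => nyy'.
  have := cP _ _ nyy'; rewrite cyy' eqxx; apply; apply/mem_fset_mulg.
  exists (y' * x^-1)%g, (y * x^-1)^-1%g; split=> //; last by rewrite invMg invgK mulgA mulgVK.
  by apply/imfsetP; exists (y * x^-1)%g.
pose best (p : 'S_N.+1) x := [arg min_(f < [` f0F]) (p (c ((val f)^-1 * x)%g) : nat)].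
pose z p x := ((val (best p x))^-1 * x)%g.
pose bad (s : G) (p : 'S_N.+1) (x : G) := z p (s * x)%g <> z p x.
pose first (p : 'S_N.+1) s x y := forall w, w \in near s x -> (p (c y) <= p (c w))%N.
have zE p s x f : s \in S -> f \in F -> first p s x (f^-1 * x)%g -> z p x = (f^-1 * x)%g.
  move=> sS fF fst; rewrite /z /best; case: arg_minnP => //= g _ /(_ [` fF] isT) /= le.
  have gn : ((val g)^-1 * x)%g \in near s x.
    by rewrite inE; apply/orP; left; apply/imfsetP; exists (val g) => //=; exact: valP.
  have fn : (f^-1 * x)%g \in near s x.
    by rewrite inE; apply/orP; left; apply/imfsetP; exists f.
  apply: (nearD s x) => //; apply: (@perm_inj _ p); apply/val_inj/eqP.
  by rewrite eqn_leq le fst.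
have zsE p s x f : s \in S -> f \in F -> first p s x (f^-1 * s * x)%g ->
    z p (s * x)%g = (f^-1 * s * x)%g.
  move=> sS fF fst; rewrite /z /best; case: arg_minnP => //= g _ /(_ [` fF] isT) /= le.
  have gn : ((val g)^-1 * s * x)%g \in near s x.
    by rewrite inE; apply/orP; right; apply/imfsetP; exists (val g) => //=; exact: valP.
  have fn : (f^-1 * s * x)%g \in near s x.
    by rewrite inE; apply/orP; right; apply/imfsetP; exists f.
  rewrite !mulgA in le *.
  apply: (nearD s x) => //; apply: (@perm_inj _ p); apply/val_inj/eqP.
  by rewrite eqn_leq le fst.
have countM s x y : s \in S -> y \in near s x ->
    (#|` F| * #|[set p : 'S_N.+1 | `[< first p s x y >]]%SET| <= N.+1`!)%N.
  move=> sS ys; pose Q := [set c (val w) | w : near s x]%SET.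
  have cQ w : w \in near s x -> c w \in Q.
    by move=> wn; apply/imsetP; exists [` wn].
  apply: leq_trans (card_perm_min (cQ _ ys)).
  apply: leq_mul; last first.
    apply: subset_leq_card; apply/subsetP => p; rewrite !inE => /asboolP fst.
    by apply/'forall_implyP => _ /imsetP[w _ ->]; apply: fst; exact: valP.
  rewrite card_imset => [|u v cuv]; last first.
    by apply/val_inj/(nearD s x); rewrite ?(valP u) ?(valP v).
  rewrite -cardfE; have <- : #|` [fset (f^-1 * x)%g | f in F]| = #|` F|.
    by rewrite card_imfset //= => f g /mulIg/invg_inj.
  by apply: fsubset_leq_card; exact: fsubsetUl.
(* The first point of [near s x] must lie in just one of the two sets: either it is [f^-1 * x] with
   [s * f] outside [F], or [f^-1 * s * x] with [s^-1 * f] outside [F]. There are at most 2|F|/m such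
   points, and each comes first for at most 1/|F| of the priorities. *)
have countbad s x : s \in S -> (m * #|[set p | `[< bad s p x >]]%SET| <= 2 * N.+1`!)%N.
  move=> sS.
  pose E1 := [fset f in F | (s * f)%g \notin F].
  pose E2 := [fset f in F | (s^-1 * f)%g \notin F].
  have E1le : (m * #|` E1| <= #|` F|)%N by apply: Ffol; rewrite !inE sS orbT.
  have E2le : (m * #|` E2| <= #|` F|)%N.
    by apply: Ffol; rewrite !inE; apply/orP; right; apply/orP; right; apply/imfsetP; exists s.
  pose B y := [set p : 'S_N.+1 | `[< first p s x y >]]%SET.
  pose ys := [seq (f^-1 * x)%g | f <- E1] ++ [seq (f^-1 * s * x)%g | f <- E2].
  have := @card_le_cover _ _ ys B [set p | `[< bad s p x >]]%SET #|` F| N.+1`!.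
  have Fpos : (0 < #|` F|)%N by rewrite cardfs_gt0.
  set nb := #|_|%SET.
  have -> : size ys = (#|` E1| + #|` E2|)%N by rewrite size_cat !size_map.
  move=> cover; rewrite -(leq_pmul2l Fpos) mulnCA.
  apply: (leq_trans (leq_mul (leqnn m) (cover _ _))); last nia.
  - move=> p; rewrite inE => /asboolP pbad.
    pose w0 := (f0^-1 * x)%g.
    have w0n : w0 \in near s x by rewrite inE; apply/orP; left; apply/imfsetP; exists f0.
    pose w := val [arg min_(w < [` w0n]) (p (c (val w)) : nat)].
    have wn : w \in near s x by exact: valP.
    have wfst : first p s x w.
      rewrite /w; case: arg_minnP => //= u _ umin v vn.
      exact: (umin [` vn]).
    exists w; last by rewrite inE; apply/asboolP.
    rewrite mem_cat; move: (wn); rewrite inE => /orP[] /imfsetP[f /= fF wE].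
      apply/orP; left; apply/mapP; exists f => //; rewrite !inE fF /=.
      apply/negP => sfF; apply: pbad; have := wfst; rewrite {1}wE => /zE -> //.
      have := wfst; rewrite wE (_ : f^-1 * x = (s * f)^-1 * s * x)%g; last by rewrite invMg mulgVK.
      exact: zsE.
    apply/orP; right; apply/mapP; exists f => //; rewrite !inE fF /=.
    apply/negP => sfF; apply: pbad; have := wfst; rewrite {1}wE => /zsE -> //.
    have := wfst; rewrite wE (_ : f^-1 * s * x = (s^-1 * f)^-1 * x)%g; last by rewrite invMg invgK.
    by move=> /zE ->.
  - move=> y; rewrite mem_cat => /orP[] /mapP[f]; rewrite !inE => /andP[fF _] ->; apply: countM => //.
      by rewrite inE; apply/orP; left; apply/imfsetP; exists f.
    by rewrite inE; apply/orP; right; apply/imfsetP; exists f.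
(* Averaging over the priorities: the pointwise count of bad ones bounds the sum of their means by
   [mean_sum_overlap], which stands in for Fubini. *)
have [p pP] : exists p, \sum_(s : S) mu (bad (val s) p) < eps.
  apply: contrapT => np.
  have : (N.+1`!)%:R * eps <= \sum_p \sum_(s : S) mu (bad (val s) p).
    rewrite -card_Sn mulr_natl -sumr_const.
    apply: ler_sum => p _; rewrite leNgt; apply/negP => lt.
    by apply: np; exists p.
  rewrite exchange_big /=; apply/negP; rewrite -ltNge.
  rewrite -(@ltr_pM2l _ m%:R) ?ltr0n // mulr_sumr.
  apply: (@le_lt_trans _ _ (\sum_(s : S) (2 * N.+1`!)%:R)).
    apply: ler_sum => s _.
    apply: (@le_trans _ _ (m%:R * ((2 * N.+1`!) %/ m)%:R)).
      rewrite ler_pM2l ?ltr0n //.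
      apply: (mean_sum_overlap mu_mean) => x; rewrite leq_divRL // mulnC.
      exact/countbad/valP.
    by rewrite -natrM ler_nat mulnC leq_trunc_div.
  rewrite sumr_const -cardfE -mulr_natr.
  have : 0 < (N.+1`!)%:R :> R by rewrite ltr0n fact_gt0.
  by move: m_gt; rewrite !natrM; nra.
exists F, (z p); split=> [x|s sS].
  by rewrite /z invMg invgK mulKVg; exact: valP.
apply: le_lt_trans pP; rewrite (bigD1 [` sS]) //= lerDl.
by apply: sumr_ge0 => t _; exact: (mean_ge0 mu_mean).
Qed.

End Partition.

(** * Tilings *)

Section BlockOffset.
Local Open Scope nat_scope.
Variables (s k : nat -> nat).

(** The formula of [blk_off] with bare functions for sizes and multiplicities, so that tilings and
    matrices share one address system. *)
Definition boff l c := (\sum_(l' < l) s l' * k l' + c * s l).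

Lemma boff_lt m l c p : l < m -> c < k l -> p < s l ->
  boff l c + p < \sum_(l' < m) s l' * k l'.
Proof.
move=> lm ck ps; apply: (@leq_trans (\sum_(l' < l.+1) s l' * k l')).
  rewrite big_ord_recr /= /boff -addnA -addnS leq_add2l; nia.
rewrite -!(big_mkord xpredT (fun l => s l * k l)).
by rewrite [leqRHS](@big_cat_nat _ _ _ l.+1) //= leq_addr.
Qed.

Lemma boff_decode m r : r < \sum_(l' < m) s l' * k l' ->
  exists l c p, [/\ l < m, c < k l, p < s l & r = boff l c + p].
Proof.
elim: m => [|m IHm]; first by rewrite big_ord0.
rewrite big_ord_recr /=; have [/IHm[l [c [p [lm ck ps rE]]]] _|le lt] := ltnP r (\sum_(l' < m) s l' * k l').
  by exists l, c, p; split=> //; exact: ltnW.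
have s0 : 0 < s m by rewrite lt0n; apply/eqP => s0; move: lt; rewrite s0 mul0n addn0 ltnNge le.
have lt' : r - \sum_(l' < m) s l' * k l' < s m * k m by rewrite ltn_subLR.
exists m, ((r - \sum_(l' < m) s l' * k l') %/ s m), ((r - \sum_(l' < m) s l' * k l') %% s m).
split; rewrite ?ltn_mod // ?ltn_divLR 1?mulnC //.
by rewrite /boff -addnA -divn_eq subnKC.
Qed.

Lemma boff_inj l c p l' c' p' :
    c < k l -> p < s l -> c' < k l' -> p' < s l' ->
    boff l c + p = boff l' c' + p' ->
  [/\ l = l', c = c' & p = p'].
Proof.
move=> ck ps ck' ps' eq_off; have [lt|lt|eql] := ltngtP l l'.
- have := boff_lt lt ck ps; rewrite eq_off /boff; lia.
- have := boff_lt lt ck' ps'; rewrite -eq_off /boff; lia.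
subst l'; move: eq_off; rewrite /boff -!addnA => /addnI eq_off.
have := congr1 (divn^~ (s l)) eq_off; have := congr1 (modn^~ (s l)) eq_off.
by rewrite !modnMDl !divnMDl ?(leq_ltn_trans _ ps) // !modn_small // !divn_small // !addn0.
Qed.

End BlockOffset.

(** * Partitions of the group into tiles and their refinement *)

Section Tilings.
Variable G : groupType.

(* A partition of [G] into finitely many kinds of tiles: [x] sits at position
   [pos x] of the tile [shp (typ x) * org x]; two points are in the same tile
   iff they have the same [org]. *)
Record tiling := Tiling {
  num : nat;
  siz : nat -> nat;
  shp : nat -> nat -> G;
  typ : G -> nat;
  org : G -> G;
  pos : G -> nat }.

(** Requiring every type to occur makes all sizes positive and gives every fine type a successor,
    hence injective connecting maps. *)
Definition tiling_spec (t : tiling) : Prop :=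
  [/\ forall x, (typ t x < num t)%N /\ (pos t x < siz t (typ t x))%N,
      forall l, (l < num t)%N -> exists x, typ t x = l,
      forall x, x = (shp t (typ t x) (pos t x) * org t x)%g,
      forall x y, org t x = org t y -> typ t x = typ t y
    & forall x p, (p < siz t (typ t x))%N ->
        org t (shp t (typ t x) p * org t x)%g = org t x /\
        pos t (shp t (typ t x) p * org t x)%g = p].

(** [cop] numbers the fine tiles of equal type inside a coarse tile. Positions follow the addresses
    of the block diagonal embedding, so that [ua_phi] will amount to cutting a coarse tile along its
    fine tiles. *)
Definition refines (t t' : tiling) (K : nat -> nat -> nat) : Prop :=
  [/\ forall j, (j < num t')%N -> siz t' j = (\sum_(l < num t) siz t l * K l j)%N,
      forall x y, org t x = org t y -> org t' x = org t' y
    & exists cop : G -> nat, forall x,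
        [/\ forall y, org t x = org t y -> cop x = cop y,
            (cop x < K (typ t x) (typ t' x))%N
          & pos t' x = (boff (siz t) (K^~ (typ t' x)) (typ t x) (cop x) + pos t x)%N]].

Definition singletons : tiling :=
  @Tiling 1%N (fun=> 1%N) (fun _ _ => 1%g) (fun=> 0%N) id (fun=> 0%N).

Lemma singletons_spec : tiling_spec singletons.
Proof.
split=> //=.
- by case=> // _; exists 1%g.
- by move=> x; rewrite mul1g.
- by move=> x [] // _; rewrite mul1g.
Qed.

(** Applying [z] to origins instead of points keeps fine tiles whole. The coarse tile with origin
    [w] is described by [code w]: for each fine type, the elements [b] of [F] such that [b * w] is
    the origin of a tile of that type sent to [w]. Only finitely many codes exist, and they are the
    coarse types. *)
Lemma coarsen (t : tiling) (F : {fset G}) (z : G -> G) :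
    tiling_spec t -> (forall x, (x * (z x)^-1)%g \in F) ->
  exists (t' : tiling) (K : nat -> nat -> nat),
    [/\ tiling_spec t', refines t t' K & forall x, org t' x = z (org t x)].
Proof.
case=> tlt tex tE ttyp tpos zF.
pose org' x := z (org t x).
pose isorg l w b := `[< exists x, org t x = (b * w)%g /\ typ t x = l >] && (z (b * w)%g == w).
pose code w := [ffun l : 'I_(num t) => [set b : F | isorg l w (val b)]].
(* Codes that do not occur are discarded, since every type has to be realized. *)
pose U := [seq c <- enum {: {ffun 'I_(num t) -> {set F}}} | `[< exists x, code (org' x) = c >]].
have uU : uniq U by rewrite filter_uniq ?enum_uniq.
have memU c : c \in U <-> exists x, code (org' x) = c.
  by rewrite mem_filter mem_enum andbT; split=> /asboolP.
pose Bl (c : {ffun 'I_(num t) -> {set F}}) l :=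
  if insub l is Some l' then [seq val b | b <- enum (c l')] else [::].
have uB c l : uniq (Bl c l).
  rewrite /Bl; case: insub => // l'.
  by rewrite map_inj_uniq ?enum_uniq //; exact: val_inj.
have BP w l b : b \in Bl (code w) l <-> [/\ (l < num t)%N, b \in F & isorg l w b].
  rewrite /Bl; case: insubP => [l' _ <-|/negPf nl]; last by split=> [|[]]; rewrite ?nl.
  split=> [/mapP[b' ]|[_ bF bo]].
    by rewrite mem_enum ffunE inE => bo ->; split=> //; [exact: ltn_ord|exact: valP].
  by apply/mapP; exists [` bF]%fset; rewrite // mem_enum ffunE inE.
pose cd j := nth (code 1%g) U j.
pose K l j := size (Bl (cd j) l).
pose siz' j := (\sum_(l < num t) siz t l * K l j)%N.
pose typ' x := index (code (org' x)) U.
have cdE x : cd (typ' x) = code (org' x) by rewrite /cd nth_index //; apply/memU; exists x.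
pose cop x := index (org t x * (org' x)^-1)%g (Bl (code (org' x)) (typ t x)).
have orgB x : (org t x * (org' x)^-1)%g \in Bl (code (org' x)) (typ t x).
  apply/BP; split; [by case: (tlt x)|exact: zF|].
  by rewrite /isorg mulgVK eqxx andbT; apply/asboolP; exists x.
have copK x : (cop x < K (typ t x) (typ' x))%N by rewrite /K cdE index_mem.
have decode v : exists w : nat * nat * nat, (v.2 < siz' v.1)%N ->
    [/\ (w.1.1 < num t)%N, (w.1.2 < K w.1.1 v.1)%N, (w.2 < siz t w.1.1)%N
      & v.2 = (boff (siz t) (K^~ v.1) w.1.1 w.1.2 + w.2)%N].
  have [lt|] := EM (v.2 < siz' v.1)%N; last by exists (0, 0, 0)%N.
  by have [l [c [p w]]] := @boff_decode (siz t) (K^~ v.1) _ _ lt; exists (l, c, p).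
have [dec decP] := choice decode.
(* The address (l, c, p) stands for position [p] of the fine shape [l], moved to its [c]-th recorded
   origin. *)
pose shp' j r := (shp t (dec (j, r)).1.1 (dec (j, r)).2 *
                  nth 1%g (Bl (cd j) (dec (j, r)).1.1) (dec (j, r)).1.2)%g.
pose pos' x := (boff (siz t) (K^~ (typ' x)) (typ t x) (cop x) + pos t x)%N.
have pos'lt x : (pos' x < siz' (typ' x))%N.
  by have [lx px] := tlt x; exact: (@boff_lt (siz t) (K^~ (typ' x)) _ _ _ _ lx (copK x) px).
exists (Tiling (size U) siz' shp' typ' org' pos'), K; split=> //=; last first.
  split=> //= [x y oxy|]; first by rewrite /org' oxy.
  exists cop => x; split=> // y oxy.
  by rewrite /cop /org' -oxy (ttyp _ _ oxy).
split=> /=.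
- by move=> x; rewrite pos'lt /typ' index_mem; split=> //; apply/memU; exists x.
- move=> j jU; have /memU[x xj] := mem_nth (code 1%g) jU.
  by exists x; rewrite /typ' xj index_uniq.
- move=> x; have /= := decP (typ' x, pos' x) (pos'lt x); rewrite /shp'.
  case: (dec _) => -[l c] p /= [ll cK ps] /esym/boff_inj[] //; first by case: (tlt x).
  move=> -> -> ->; rewrite cdE nth_index // mulgA mulgVK; exact: tE.
- by move=> x y oxy; rewrite /typ' oxy.
- move=> x r rlt; have /= := decP (typ' x, r) rlt; rewrite /shp'.
  case: (dec _) => -[l c] p /= [ll cK ps rE]; set b := nth _ _ _.
  have bB : b \in Bl (code (org' x)) l by rewrite /b cdE mem_nth // -cdE.
  have /BP[_ bF /andP[/asboolP[x0 [ox0 tx0]] /eqP zb]] := bB.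
  rewrite -mulgA -ox0 -tx0.
  have := tpos x0 p; rewrite tx0 => /(_ ps)[oy py].
  set y := (_ * _)%g in oy py *.
  have ty : typ t y = l by rewrite (ttyp _ _ oy).
  have o'y : org' y = org' x by rewrite /org' oy ox0 zb.
  split=> //; rewrite /pos' rE ty py /typ' o'y -/(typ' x).
  by rewrite /cop ty o'y oy ox0 mulgK /b cdE index_uniq // -cdE.
Qed.

Variables (e : nat -> G) (mu : (G -> Prop) -> R).
Hypothesis e_surj : forall g, exists n, e n = g.
Hypothesis mu_mean : invariant_mean mu.

(** The origins of [x] and [s * x] are [d * x] and [d' * s * x] with [d], [d'] in the finite set
    [D]. If [z] takes the value [z x] at both, the coarse tile is the same; so the boundary of [S]
    is covered by the sets that [small_boundary] controls for [S']. *)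
Lemma coarsen_small (t : tiling) (S : {fset G}) (eps : R) :
    tiling_spec t -> 0 < eps ->
  exists (t' : tiling) (K : nat -> nat -> nat),
    [/\ tiling_spec t', refines t t' K
      & forall s, s \in S -> mu (fun x => org t' (s * x)%g <> org t' x) < eps].
Proof.
move=> tP eps0; have [tlt tex tE ttyp tpos] := tP.
pose D := [fset (shp t l p)^-1%g | l in iota 0 (num t),
                                 p in iota 0 (\max_(l < num t) siz t l)]%fset.
have orgD x : exists2 d, d \in D & org t x = (d * x)%g.
  exists (shp t (typ t x) (pos t x))^-1%g; last by rewrite [X in (_ * X)%g]tE mulKg.
  have [tx px] := tlt x; apply/imfset2P; exists (typ t x); first by rewrite /= mem_iota.
  exists (pos t x); rewrite //= mem_iota add0n; apply: (leq_trans px).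
  exact: (leq_bigmax (Ordinal tx)).
pose S' := (D `|` fset_mulg D S)%fset.
(* Exceeds the number of sets in the union bound, and is positive even for empty [S']. *)
pose q : R := 2 * (size S').+1%:R.
have q0 : 0 < q by rewrite mulr_gt0 ?ltr0n.
have [F [z [zF zS]]] := small_boundary e_surj mu_mean S' (divr_gt0 eps0 q0).
have [t' [K [t'P ref orgE]]] := coarsen tP zF.
exists t', K; split=> // s sS.
apply: (@le_lt_trans _ _ ((size S')%:R * (eps / q))).
  apply: (@mean_union_le _ _ mu_mean G S' (fun g x => z (g * x)%g <> z x)).
    by move=> g gS; exact/ltW/zS.
  move=> x; rewrite !orgE => nz; apply: contrapT => nex; apply: nz.
  have good g : g \in S' -> z (g * x)%g = z x.
    by move=> gS; apply: contrapT => ng; apply: nex; exists g.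
  have [d dD ->] := orgD x; have [d' dD' ->] := orgD (s * x)%g.
  rewrite mulgA !good // inE ?dD //; apply/orP; right; apply/mem_fset_mulg.
  by exists d', s.
rewrite mulrCA gtr_pMr // ltr_pdivrMr // mul1r /q -natr1.
have : 0 <= (size S')%:R :> R by rewrite ler0n.
lra.
Qed.

(** Level [n] controls the first [n] elements of the enumeration, so each group element is
    eventually controlled, with summable errors. Level 0 has nothing to control and may consist of
    single points. *)
Lemma tiling_tower : exists (T : nat -> tiling) (K : nat -> nat -> nat -> nat),
  forall n, [/\ tiling_spec (T n), refines (T n) (T n.+1) (K n)
    & forall k, (k < n)%N -> mu (fun x => org (T n) (e k * x)%g <> org (T n) x) < 2^-1 ^+ n].
Proof.
have step (v : nat * {t | tiling_spec t}) : exists t' : {t | tiling_spec t},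
    (exists K, refines (sval v.2) (sval t') K) /\
    forall k, (k <= v.1)%N -> mu (fun x => org (sval t') (e k * x)%g <> org (sval t') x) < 2^-1 ^+ v.1.+1.
  case: v => n [t tP] /=.
  have eps0 : 0 < 2^-1 ^+ n.+1 :> R by rewrite exprn_gt0 // invr_gt0.
  have [t' [K [t'P ref small]]] := coarsen_small [fset e k | k in iota 0 n.+1]%fset tP eps0.
  exists (exist _ t' t'P); split; first by exists K.
  move=> k kn; apply/small/imfsetP; exists k => //.
  by have : k \in iota 0 n.+1 by rewrite mem_iota ltnS.
have [next nextP] := choice step.
pose T := fix T n := if n is m.+1 then next (m, T m) else exist _ singletons singletons_spec.
have /choice[K KP] n : exists K, refines (sval (T n)) (sval (T n.+1)) K.
  by case: (nextP (n, T n)).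
exists (fun n => sval (T n)), K => n; split=> //; first exact: (svalP (T n)).
by case: n => // n k kn; case: (nextP (n, T n)) => _; apply.
Qed.

End Tilings.

(** * Matrix rank *)

Section MatrixRank.
Variable K : fieldType.

Lemma mxrank_sum_le (I : Type) (r : seq I) (Q : pred I) m n (A : I -> 'M[K]_(m, n)) :
  (\rank (\sum_(i <- r | Q i) A i)%R <= \sum_(i <- r | Q i) \rank (A i))%N.
Proof.
elim/big_rec2: _ => [|i k B _ le]; first by rewrite mxrank0.
by apply: leq_trans (mxrank_add _ _) _; rewrite leq_add2l.
Qed.

Lemma mxrank_le_cols m n (A : 'M[K]_(m, n)) :
  (\rank A <= #|[set j | [exists i, A i j != 0%R]]|)%N.
Proof.
set S := [set j | _].
have -> : A = \sum_(j in S) col j A *m delta_mx (ord0 : 'I_1) j.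
  apply/matrixP => i j; rewrite summxE.
  have entry k : (col k A *m delta_mx (ord0 : 'I_1) k) i j = if k == j then A i j else 0.
    rewrite mxE big_ord1 !mxE eqxx /= eq_sym.
    by case: eqP => [->|_]; rewrite ?mulr1 ?mulr0.
  under eq_bigr do rewrite entry.
  rewrite -big_mkcondr /=; have [jS|jS] := boolP (j \in S).
    by rewrite (big_pred1 j) // => k; rewrite /= andbC; case: (altP (k =P j)) => // ->.
  rewrite big_pred0; last by move=> k; case: (altP (k =P j)) => [->|_]; rewrite ?(negPf jS) ?andbF.
  by apply/eqP/contraT => nz; move: jS; rewrite inE => /existsP[]; exists i.
apply: leq_trans (mxrank_sum_le _ _ _) _; rewrite -sum1_card; apply: leq_sum => j _.
exact: leq_trans (mxrankM_maxl _ _) (rank_leq_col _).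
Qed.

(* A maximal family of independent columns occupies at most [k * \rank A] rows,
   and every nonzero column has a nonzero entry in one of these rows. *)
Lemma mxrank_ge_cols m n (A : 'M[K]_(m, n)) (k : nat) :
    (forall j, (#|[set i | A i j != 0%R]| <= k)%N) ->
    (forall i, (#|[set j | A i j != 0%R]| <= k)%N) ->
  (#|[set j | [exists i, A i j != 0%R]]| <= k * k * \rank A)%N.
Proof.
move=> colk rowk; rewrite -mxrank_tr.
pose f := maxrankfun A^T.
have spanA : (A^T <= rowsub f A^T)%MS by rewrite eq_maxrowsub.
pose T := [set i | [exists t, A i (f t) != 0]].
have Tk : (1 * #|T| <= size (enum 'I_(\rank A^T)) * k)%N.
  apply: (@card_le_cover _ _ _ (fun t => [set i | A i (f t) != 0])).
    by move=> i; rewrite inE => /existsP[t nz]; exists t; rewrite ?mem_enum ?inE.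
  by move=> t _; rewrite mul1n colk.
have : (1 * #|[set j | [exists i, A i j != 0%R]]| <= size (enum T) * k)%N.
  apply: (@card_le_cover _ _ _ (fun i => [set j | A i j != 0])); last first.
    by move=> i _; rewrite mul1n rowk.
  move=> j; rewrite inE => /existsP[i0 nz].
  suff /existsP[i /andP[iT Aij]] : [exists i, (i \in T) && (A i j != 0)].
    by exists i; [rewrite mem_enum|rewrite inE].
  apply/contraT => /existsPn none; case/negP: nz; apply/eqP.
  have [i0T|i0T] := boolP (i0 \in T); first by have := none i0; rewrite i0T negbK => /eqP.
  have /submxP[B AE] := spanA.
  have /matrixP/(_ j i0) := AE; rewrite !mxE => ->.
  rewrite big1 // => t _; rewrite !mxE; apply/eqP; rewrite mulf_eq0; apply/orP; right.
  by apply/contraT => nz; move: i0T; rewrite inE => /existsP[]; exists t.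
move: Tk; rewrite -!cardE card_ord; nia.
Qed.

Lemma mxrank_block m n p q (A : 'M[K]_(m, n)) (B : 'M_(m, q)) (C : 'M_(p, n)) (D : 'M_(p, q)) :
  (\rank (block_mx A B C D) <= \rank A + \rank B + \rank C + \rank D)%N.
Proof.
have rcol r s t (M : 'M[K]_(r, t)) (N : 'M_(s, t)) : (\rank (col_mx M N) <= \rank M + \rank N)%N.
  by rewrite -addsmxE mxrank_adds_leqif.
rewrite block_mxEv; apply: leq_trans (rcol _ _ _ _ _) _; rewrite -addnA.
have rrow r s t (M : 'M[K]_(r, s)) (N : 'M_(r, t)) : (\rank (row_mx M N) <= \rank M + \rank N)%N.
  by rewrite -mxrank_tr tr_row_mx -(mxrank_tr M) -(mxrank_tr N).
exact: leq_add.
Qed.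

(* For orthogonal idempotents [M] and [N] the last four ranks vanish. *)
Lemma mxrank_almost_orth n (M N : 'M[K]_n) (X := M + N) :
  (\rank M + \rank N <= \rank X + \rank (M - M *m X *m M)%R + \rank (M *m X *m N)
                        + \rank (N *m X *m M) + \rank (N - N *m X *m N)%R)%N.
Proof.
rewrite -rank_diag_block_mx.
(* The first summand factors through [X], so its rank is at most that of [X]; the blocks of the
   second are the four error terms. *)
have -> : block_mx M 0 0 N = col_mx M N *m X *m row_mx M N +
    block_mx (M - M *m X *m M) (- (M *m X *m N)) (- (N *m X *m M)) (N - N *m X *m N).
  by rewrite mul_col_mx mul_col_row add_block_mx; congr block_mx; rewrite ?subrr // addrC subrK.
apply: leq_trans (mxrank_add _ _) _; rewrite -!addnA; apply: leq_add.
  exact: leq_trans (mxrankM_maxl _ _) (mxrankM_maxr _ _).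
by apply: leq_trans (mxrank_block _ _ _ _) _; rewrite !mxrank_opp !addnA.
Qed.

(** The rows of the [J i] are orthonormal coordinates on mutually orthogonal blocks. The row spaces
    of the summands are independent, and each summand is recovered as a left multiple of the sum. *)
Lemma mxrank_orth_sum (I : finType) m (d : I -> nat) (J : forall i, 'M[K]_(d i, m))
    (a : forall i, 'M[K]_(d i)) :
    (forall i, J i *m (J i)^T = 1%:M) ->
    (forall i j, i != j -> J i *m (J j)^T = 0) ->
  \rank (\sum_i (J i)^T *m a i *m J i)%R = (\sum_i \rank (a i))%N.
Proof.
move=> J1 J0; pose A i := (J i)^T *m a i *m J i; set X := (\sum_i _)%R.
have JA i : J i *m A i = a i *m J i by rewrite /A !mulmxA J1 mul1mx.
have JA0 i j : i != j -> J i *m A j = 0 by move=> ij; rewrite /A !mulmxA J0 // !mul0mx.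
have AJ i : A i *m (J i)^T = (J i)^T *m a i by rewrite /A -!mulmxA J1 mulmx1.
have AJ0 i j : j != i -> A j *m (J i)^T = 0 by move=> ji; rewrite /A -!mulmxA J0 // !mulmx0.
have rankA i : \rank (A i) = \rank (a i).
  apply/eqP; rewrite eqn_leq; apply/andP; split.
    exact: leq_trans (mxrankM_maxl _ _) (mxrankM_maxr _ _).
  have {1}-> : a i = J i *m A i *m (J i)^T by rewrite JA -mulmxA J1 mulmx1.
  exact: leq_trans (mxrankM_maxl _ _) (mxrankM_maxr _ _).
apply/eqP; rewrite eqn_leq; apply/andP; split.
  by apply: leq_trans (mxrank_sum_le _ _ _) _; apply: leq_sum => i _; rewrite rankA.
have dir : mxdirect (\sum_i A i)%MS.
  apply/mxdirect_sumsP => i _; apply/eqP; rewrite -submx0; apply/rV_subP => v.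
  rewrite sub_capmx => /andP[/submxP[w ->] /sub_sumsmxP[u vE]].
  have : w *m A i *m (J i)^T = 0.
    rewrite vE mulmx_suml big1 // => j ji.
    by rewrite -mulmxA AJ0 // mulmx0.
  rewrite -mulmxA AJ mulmxA => wa0.
  by rewrite /A !mulmxA wa0 mul0mx sub0mx.
rewrite (eq_bigr (fun i => \rank (A i))) => [|i _]; last by rewrite rankA.
rewrite -(mxdirectP dir) /=; apply: mxrankS; apply/sumsmx_subP => i _.
have -> : A i = (J i)^T *m J i *m X.
  rewrite -mulmxA mulmx_sumr (bigD1 i) //= big1 ?addr0 => [|j ji].
    by rewrite JA mulmxA.
  by rewrite JA0 // eq_sym.
exact: submxMl.
Qed.

End MatrixRank.

(** * Completion of a ring with a pseudo-rank *)

Section RealLimits.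
Implicit Types (u v : nat -> R) (a b l : R).

Definition tends u l := forall eps : R, 0 < eps ->
  exists N, forall n, (N <= n)%N -> `|u n - l| < eps.

Lemma cauchy_tends u :
    (forall eps : R, 0 < eps -> exists N, forall m n, (N <= m)%N -> (N <= n)%N ->
       `|u m - u n| < eps) ->
  exists l, tends u l.
Proof.
move=> cu; have [l ul] : {l | Rseries.Un_cv u l}.
  apply: Rcomplete.R_complete => eps /RltP/cu[N uN].
  by exists N => m n /ssrnat.leP Nm /ssrnat.leP Nn; rewrite /Rfunctions.R_dist; apply/RltP; rewrite RabsE; exact: uN.
exists l => eps /RltP/ul[N uN]; exists N => n /ssrnat.leP/uN.
by rewrite /Rfunctions.R_dist => /RltP; rewrite RabsE.
Qed.

Lemma tends_cst a : tends (fun=> a) a.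
Proof. by move=> eps eps0; exists 0%N => n _; rewrite subrr normr0. Qed.

Lemma tendsD u v a b : tends u a -> tends v b -> tends (fun n => u n + v n) (a + b).
Proof.
move=> ua vb eps eps0; have e2 : 0 < eps / 2 by lra.
have [[N uN] [M vM]] := (ua _ e2, vb _ e2); exists (maxn N M) => n.
rewrite geq_max => /andP[/uN un /vM vn].
by rewrite opprD addrACA (le_lt_trans (ler_normD _ _)) //; lra.
Qed.

Lemma tends_le u v a b : tends u a -> tends v b ->
  (exists N, forall n, (N <= n)%N -> u n <= v n) -> a <= b.
Proof.
move=> ua vb [N0 uv]; rewrite leNgt; apply/negP => ba.
have e2 : 0 < (a - b) / 2 by lra.
have [[N uN] [M vM]] := (ua _ e2, vb _ e2).
have := uv _ (leq_maxl N0 (maxn N M)).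
have /uN : (N <= maxn N0 (maxn N M))%N by rewrite !leq_max leqnn orbT.
have /vM : (M <= maxn N0 (maxn N M))%N by rewrite !leq_max leqnn !orbT.
by rewrite !ltr_norml; lra.
Qed.

Lemma tends_uniq u a b : tends u a -> tends u b -> a = b.
Proof.
move=> ua ub; apply/le_anti/andP; split; [apply: (tends_le ua ub)|apply: (tends_le ub ua)];
  by exists 0%N.
Qed.

Lemma tends_ext u v a : (forall n, u n = v n) -> tends u a -> tends v a.
Proof. by move=> /funext->. Qed.

Lemma half_expn_small (eps : R) : 0 < eps -> exists N, forall n, (N <= n)%N -> 2^-1 ^+ n < eps.
Proof.
move=> eps0; pose N := Num.Def.archi_bound eps^-1; exists N => n Nn.
have epsV : eps^-1 < n%:R.
  have e0 : 0 <= eps^-1 by rewrite invr_ge0 ltW.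
  by apply: lt_le_trans (archi_boundP e0) _; rewrite ler_nat.
have n2 : (n%:R : R) < 2 ^+ n by rewrite -natrX ltr_nat ltn_expl.
rewrite exprVn invf_plt ?posrE ?exprn_gt0 //; exact: lt_trans n2.
Qed.

End RealLimits.

(** An idempotent of the completion is represented by elements that need not be idempotent, so
    additivity on orthogonal idempotents cannot be passed to the limit directly. The last clause
    concerns arbitrary elements and continuous expressions, hence survives limits; on orthogonal
    idempotents its four error terms vanish and it gives back additivity. *)
Definition pseudo_rank (A : pzRingType) (rho : A -> R) : Prop :=
  [/\ rho 0 = 0 /\ rho 1 = 1,
      forall x, 0 <= rho x,
      forall x y, rho (x + y) <= rho x + rho y /\ rho (- x) = rho x,
      forall x y, rho (x * y) <= rho x /\ rho (x * y) <= rho y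
    & forall x y, let s := x + y in
        rho x + rho y <= rho s + rho (x - x * s * x) + rho (x * s * y)
                         + rho (y * s * x) + rho (y - y * s * y)].

(** A quotient by a relation without decision procedure: equivalent points have equal classes by
    extensionality, hence the same chosen element. Points of the completion can then be Cauchy
    sequences in chosen form, with plain equality. *)
Lemma canonical_representative (T : Type) (r : T -> T -> Prop) :
    (forall x, r x x) -> (forall x y, r x y -> r y x) ->
    (forall x y z, r x y -> r y z -> r x z) ->
  {canon : T -> T | forall x, r x (canon x) & forall x y, r x y -> canon x = canon y}.
Proof.
move=> refl sym trans.
pose f (P : {P : T -> Prop | exists y, P y}) := sval (cid (svalP P)).
exists (fun x => f (exist _ (r x) (ex_intro _ x (refl x)))) => [x|x y rxy].
  exact: (svalP (cid _)).
congr (f _); apply: eq_exist; apply/funext => z; apply/propext.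
by split; apply: trans; [exact: sym|].
Qed.

Section Completion.
Variables (A : pzRingType) (rho : A -> R).
Hypothesis rho_pr : pseudo_rank rho.

Let rho0 : rho 0 = 0. Proof. by case: rho_pr => -[]. Qed.
Let rho1 : rho 1 = 1. Proof. by case: rho_pr => -[]. Qed.
Let rho_ge0 x : 0 <= rho x. Proof. by case: rho_pr => _ /(_ x). Qed.
Let rhoD x y : rho (x + y) <= rho x + rho y. Proof. by case: rho_pr => _ _ /(_ x y)[]. Qed.
Let rhoN x : rho (- x) = rho x. Proof. by case: rho_pr => _ _ /(_ x x)[]. Qed.
Let rhoMl x y : rho (x * y) <= rho x. Proof. by case: rho_pr => _ _ _ /(_ x y)[]. Qed.
Let rhoMr x y : rho (x * y) <= rho y. Proof. by case: rho_pr => _ _ _ /(_ x y)[]. Qed.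

Let rhoBC x y : rho (x - y) = rho (y - x). Proof. by rewrite -rhoN opprB. Qed.

Let rho_tri y x z : rho (x - z) <= rho (x - y) + rho (y - z).
Proof. by have := rhoD (x - y) (y - z); rewrite addrA subrK. Qed.

Let rho_dist x y : `|rho x - rho y| <= rho (x - y).
Proof.
have := rhoD (x - y) y; have := rhoD (y - x) x; rewrite !subrK rhoBC.
by rewrite ler_norml; lra.
Qed.

Definition cauchy (c : nat -> A) := forall eps : R, 0 < eps ->
  exists N, forall m n, (N <= m)%N -> (N <= n)%N -> rho (c m - c n) < eps.

Definition same_limit (c d : nat -> A) := tends (fun n => rho (c n - d n)) 0.

Let same_limitE c d : same_limit c d <-> forall eps : R, 0 < eps ->
  exists N, forall n, (N <= n)%N -> rho (c n - d n) < eps.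
Proof.
by split=> h eps /h[N cd]; exists N => n /cd; rewrite subr0 ger0_norm.
Qed.

Let same_limit_refl c : same_limit c c.
Proof. by apply/same_limitE => eps eps0; exists 0%N => n _; rewrite subrr rho0. Qed.

Let same_limit_sym c d : same_limit c d -> same_limit d c.
Proof.
by move=> /same_limitE cd; apply/same_limitE => eps /cd[N h]; exists N => n /h; rewrite rhoBC.
Qed.

Let same_limit_trans d c f : same_limit c d -> same_limit d f -> same_limit c f.
Proof.
move=> cd df; have := tendsD cd df; rewrite addr0 => h.
apply/same_limitE => eps /h[N hN]; exists N => n /hN.
rewrite subr0 ger0_norm ?addr_ge0 //; exact: le_lt_trans.
Qed.

Let canonS := canonical_representative same_limit_refl same_limit_sym
  (fun c d f => @same_limit_trans d c f).
Let canon := s2val canonS.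
Let canonP c : same_limit c (canon c). Proof. exact: (s2valP canonS). Qed.
Let canon_eq c d : same_limit c d -> canon c = canon d. Proof. exact: (s2valP' canonS). Qed.

Let cauchy_same c d : same_limit c d -> cauchy c -> cauchy d.
Proof.
move=> /same_limitE cd cc eps eps0; have e3 : 0 < eps / 3 by lra.
have [[N hN] [M hM]] := (cd _ e3, cc _ e3); exists (maxn N M) => m n.
rewrite !geq_max => /andP[/hN Nm Mm] /andP[/hN Nn Mn].
have := hM _ _ Mm Mn; have := rho_tri (c m) (d m) (d n); have := rho_tri (c n) (c m) (d n).
by rewrite (rhoBC (d m) (c m)); lra.
Qed.

Let cauchy_cst a : cauchy (fun=> a).
Proof. by move=> eps eps0; exists 0%N => m n _ _; rewrite subrr rho0. Qed.

Let cauchyN c : cauchy c -> cauchy (fun n => - c n).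
Proof.
move=> cc eps /cc[N hN]; exists N => m n Nm Nn.
by rewrite -opprD rhoN; exact: hN.
Qed.

Let cauchyD c d : cauchy c -> cauchy d -> cauchy (fun n => c n + d n).
Proof.
move=> cc cd eps eps0; have e2 : 0 < eps / 2 by lra.
have [[N hN] [M hM]] := (cc _ e2, cd _ e2); exists (maxn N M) => m n.
rewrite !geq_max => /andP[Nm Mm] /andP[Nn Mn].
have := hN _ _ Nm Nn; have := hM _ _ Mm Mn; have := rhoD (c m - c n) (d m - d n).
by rewrite opprD addrACA; lra.
Qed.

Let rhoM_dist a b a' b' : rho (a * b - a' * b') <= rho (a - a') + rho (b - b').
Proof.
have -> : a * b - a' * b' = (a - a') * b + a' * (b - b').
  by rewrite mulrBl mulrBr addrA subrK.
have := rhoD ((a - a') * b) (a' * (b - b')); have := rhoMl (a - a') b.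
by have := rhoMr a' (b - b'); lra.
Qed.

Let cauchyM c d : cauchy c -> cauchy d -> cauchy (fun n => c n * d n).
Proof.
move=> cc cd eps eps0; have e2 : 0 < eps / 2 by lra.
have [[N hN] [M hM]] := (cc _ e2, cd _ e2); exists (maxn N M) => m n.
rewrite !geq_max => /andP[Nm Mm] /andP[Nn Mn].
have := hN _ _ Nm Nn; have := hM _ _ Mm Mn; have := rhoM_dist (c m) (d m) (c n) (d n).
by lra.
Qed.

Record completion := Completion {
  approx : nat -> A;
  _ : cauchy approx /\ canon approx = approx }.

Let approx_inj (x y : completion) : approx x = approx y -> x = y.
Proof.
case: x y => [c hc] [d hd] /= cd; subst d; congr Completion; exact: Prop_irrelevance.
Qed.

Let limP c : cauchy c -> cauchy (canon c) /\ canon (canon c) = canon c.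
Proof.
move=> cc; split; first exact: cauchy_same (canonP c) cc.
by apply: canon_eq; apply: same_limit_sym; exact: canonP.
Qed.

Let limit c (cc : cauchy c) : completion := Completion (limP cc).

Let limit_eq c d (cc : cauchy c) (cd : cauchy d) : same_limit c d -> limit cc = limit cd.
Proof. by move=> h; apply: approx_inj; exact: canon_eq. Qed.

Let limit_ext c d (cc : cauchy c) (cd : cauchy d) : (forall n, c n = d n) -> limit cc = limit cd.
Proof. by move=> /funext cd'; apply: limit_eq; rewrite cd'. Qed.

Let approx_cauchy x : cauchy (approx x). Proof. by case: x => c []. Qed.

Let approxK x : limit (@approx_cauchy x) = x.
Proof. by apply: approx_inj; case: x => c []. Qed.

Let approx_limit c (cc : cauchy c) : same_limit (approx (limit cc)) c.
Proof. by apply: same_limit_sym; exact: canonP. Qed.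

Let inj a : completion := limit (@cauchy_cst a).
Let add x y := limit (cauchyD (@approx_cauchy x) (@approx_cauchy y)).
Let opp x := limit (cauchyN (@approx_cauchy x)).
Let mul x y := limit (cauchyM (@approx_cauchy x) (@approx_cauchy y)).

Let limitD c d (cc : cauchy c) (cd : cauchy d) : add (limit cc) (limit cd) = limit (cauchyD cc cd).
Proof.
apply: limit_eq; have := tendsD (approx_limit cc) (approx_limit cd); rewrite addr0 => h.
apply/same_limitE => eps /h[N hN]; exists N => n /hN.
rewrite subr0 ger0_norm ?addr_ge0 // opprD addrACA; exact: le_lt_trans.
Qed.

Let limitM c d (cc : cauchy c) (cd : cauchy d) : mul (limit cc) (limit cd) = limit (cauchyM cc cd).
Proof.
apply: limit_eq; have := tendsD (approx_limit cc) (approx_limit cd); rewrite addr0 => h.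
apply/same_limitE => eps /h[N hN]; exists N => n /hN.
rewrite subr0 ger0_norm ?addr_ge0 //; apply: le_lt_trans; exact: rhoM_dist.
Qed.

Let limitN c (cc : cauchy c) : opp (limit cc) = limit (cauchyN cc).
Proof.
apply: limit_eq; apply/same_limitE => eps /(proj1 (same_limitE _ _) (approx_limit cc))[N hN].
by exists N => n /hN; rewrite -opprD rhoN.
Qed.

HB.instance Definition _ := gen_eqMixin completion.
HB.instance Definition _ := gen_choiceMixin completion.

Let addA : associative add.
Proof.
move=> x y z; rewrite -(approxK x) -(approxK y) -(approxK z) !limitD.
by apply: limit_ext => n; rewrite addrA.
Qed.

Let addC : commutative add.
Proof. by move=> x y; apply: limit_ext => n; rewrite addrC. Qed.

Let add0 : left_id (inj 0) add.
Proof.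
by move=> x; rewrite -[in RHS](approxK x) -{1}(approxK x) limitD; apply: limit_ext => n; rewrite add0r.
Qed.

Let addN : left_inverse (inj 0) opp add.
Proof.
by move=> x; rewrite -(approxK x) limitN limitD; apply: limit_ext => n; rewrite addNr.
Qed.

HB.instance Definition _ := GRing.isZmodule.Build completion addA addC add0 addN.

Let mulA : associative mul.
Proof.
move=> x y z; rewrite -(approxK x) -(approxK y) -(approxK z) !limitM.
by apply: limit_ext => n; rewrite mulrA.
Qed.

Let mul1 : left_id (inj 1) mul.
Proof.
by move=> x; rewrite -[in RHS](approxK x) -{1}(approxK x) limitM; apply: limit_ext => n; rewrite mul1r.
Qed.

Let mulx1 : right_id (inj 1) mul.
Proof.
by move=> x; rewrite -[in RHS](approxK x) -{1}(approxK x) limitM; apply: limit_ext => n; rewrite mulr1.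
Qed.

Let mulDl : left_distributive mul +%R.
Proof.
move=> x y z; rewrite -(approxK x) -(approxK y) -(approxK z) /+%R/= !(limitM, limitD).
by apply: limit_ext => n; rewrite mulrDl.
Qed.

Let mulDr : right_distributive mul +%R.
Proof.
move=> x y z; rewrite -(approxK x) -(approxK y) -(approxK z) /+%R/= !(limitM, limitD).
by apply: limit_ext => n; rewrite mulrDr.
Qed.

Let rk_ex (x : completion) : exists l, tends (fun n => rho (approx x n)) l.
Proof.
apply: cauchy_tends => eps /(@approx_cauchy x)[N hN]; exists N => m n Nm Nn.
exact: le_lt_trans (rho_dist _ _) (hN _ _ Nm Nn).
Qed.

Let rk x : R := sval (cid (rk_ex x)).
Let rkP x : tends (fun n => rho (approx x n)) (rk x).
Proof. exact: (svalP (cid (rk_ex x))). Qed.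

Let rk_limit c (cc : cauchy c) : tends (fun n => rho (c n)) (rk (limit cc)).
Proof.
move=> eps eps0; have e2 : 0 < eps / 2 by lra.
have [[N hN] [M hM]] := (@rkP (limit cc) _ e2, approx_limit cc e2); exists (maxn N M) => n.
rewrite geq_max => /andP[/hN Nn /hM]; rewrite subr0 ger0_norm // => Mn.
by have := rho_dist (approx (limit cc) n) (c n); move: Nn; rewrite !ltr_norml ler_norml; lra.
Qed.

Let rk_inj a : rk (inj a) = rho a.
Proof. exact: tends_uniq (rk_limit (cauchy_cst a)) (@tends_cst _). Qed.

Let one_neq0 : inj 1 != 0.
Proof.
by apply/eqP => /(congr1 rk); rewrite !rk_inj rho1 rho0; apply/eqP/oner_neq0.
Qed.

HB.instance Definition _ :=
  GRing.Zmodule_isNzRing.Build completion mulA mul1 mulx1 mulDl mulDr one_neq0.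

Let rk_eq0 (x : completion) : rk x = 0 -> x = 0.
Proof.
move=> rx; rewrite -(approxK x); apply: limit_eq; have := @rkP x; rewrite rx.
by apply: tends_ext => n; rewrite subr0.
Qed.

Let rk_ge0 x : 0 <= rk x.
Proof. by apply: tends_le (@tends_cst 0) (@rkP x) _; exists 0%N. Qed.

Let limitDE c d (cc : cauchy c) (cd : cauchy d) :
  (limit cc : completion) + limit cd = limit (cauchyD cc cd).
Proof. exact: limitD. Qed.
Let limitME c d (cc : cauchy c) (cd : cauchy d) :
  (limit cc : completion) * limit cd = limit (cauchyM cc cd).
Proof. exact: limitM. Qed.
Let limitNE c (cc : cauchy c) : - (limit cc : completion) = limit (cauchyN cc).
Proof. exact: limitN. Qed.
Let limitE := (limitME, limitNE, limitDE).

Let rk_almost_orth (x y : completion) (s := x + y) :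
  rk x + rk y <= rk s + rk (x - x * s * x) + rk (x * s * y)
                 + rk (y * s * x) + rk (y - y * s * y).
Proof.
rewrite /s -(approxK x) -(approxK y) !limitE.
apply: tends_le (tendsD (rk_limit _) (rk_limit _))
  (tendsD (tendsD (tendsD (tendsD (rk_limit _) (rk_limit _)) (rk_limit _)) (rk_limit _)) (rk_limit _)) _.
by exists 0%N => n _; case: rho_pr => _ _ _ _; apply.
Qed.

Lemma completion_exists :
  exists (Rb : nzRingType) (rkb : Rb -> R) (j : A -> Rb),
  [/\ rank_function rkb,
      [/\ j 1 = 1, forall a b, j (a + b) = j a + j b, forall a, j (- a) = - j a
        & forall a b, j (a * b) = j a * j b],
      forall a, rkb (j a) = rho a,
      (forall u : nat -> Rb,
         (forall eps : R, 0 < eps -> exists N, forall m k, (N <= m)%N -> (N <= k)%N ->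
              rkb (u m - u k) < eps) ->
         exists x, forall eps : R, 0 < eps -> exists N, forall m, (N <= m)%N ->
              rkb (u m - x) < eps)
    & forall (x : Rb) (eps : R), 0 < eps -> exists a, rkb (x - j a) < eps].
Proof.
have rkD (x y : completion) : rk (x + y) <= rk x + rk y.
  rewrite -(approxK x) -(approxK y) limitE.
  by apply: tends_le (rk_limit _) (tendsD (rk_limit _) (rk_limit _)) _; exists 0%N.
have rkN (x : completion) : rk (- x) = rk x.
  rewrite -(approxK x) limitE; apply: tends_uniq (rk_limit _).
  by apply: tends_ext (rk_limit _) => n; rewrite rhoN.
have near_approx (x : completion) (eps : R) : 0 < eps ->
    exists N, forall n, (N <= n)%N -> rk (x - inj (approx x n)) < eps.
  move=> eps0; have e2 : 0 < eps / 2 by lra.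
  have [N hN] := @approx_cauchy x _ e2; exists N => n Nn.
  apply: (@le_lt_trans _ _ (eps / 2)); last lra.
  rewrite -{1}(approxK x) /inj limitE limitE.
  by apply: tends_le (rk_limit _) (@tends_cst _) _; exists N => m Nm; exact/ltW/hN.
exists completion, rk, inj; split=> //.
- split.
  + by rewrite rk_inj.
  + move=> x y; rewrite -(approxK x) -(approxK y) limitE.
    by split; apply: tends_le (rk_limit _) (rk_limit _) _; exists 0%N.
  + move=> e f ee ff ef fe; apply/le_anti/andP; split=> //.
    have := rk_almost_orth e f; rewrite /= !(mulrDl, mulrDr).
    rewrite !(ee, ff, ef, fe, mulr0, mul0r, addr0, add0r, subrr).
    have -> : rk 0 = 0 by rewrite rk_inj.
    lra.
  + move=> x x0; rewrite lt_neqAle rk_ge0 andbT eq_sym.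
    by apply/eqP => /rk_eq0/eqP; rewrite (negPf x0).
  + exact: rkD.
- by split=> [//|a b|a|a b]; rewrite /inj limitE; apply: limit_ext.
- move=> u cu.
  (* Elements of [A] within 2^-k of [u k] form a Cauchy sequence in [A], whose class is the limit
     sought. *)
  have /choice[a ua] k : exists a, rk (u k - inj a) < 2^-1 ^+ k.
    have [|N hN] := @near_approx (u k) (2^-1 ^+ k); first by rewrite exprn_gt0 // invr_gt0.
    by exists (approx (u k) N); exact: hN.
  have rk_tri (y x z : completion) : rk (x - z) <= rk (x - y) + rk (y - z).
    by have := rkD (x - y) (y - z); rewrite addrA subrK.
  have ca : cauchy a.
    move=> eps eps0; have e3 : 0 < eps / 3 by lra.
    have [[N hN] [M hM]] := (cu _ e3, half_expn_small e3); exists (maxn N M) => m n.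
    rewrite !geq_max => /andP[Nm Mm] /andP[Nn Mn].
    rewrite -rk_inj; have -> : inj (a m - a n) = inj (a m) - inj (a n).
      by rewrite /inj !limitE; apply: limit_ext.
    have := rk_tri (u m) (inj (a m)) (inj (a n)); have := rk_tri (u n) (u m) (inj (a n)).
    have := hN _ _ Nm Nn; have := hM _ Mm; have := hM _ Mn; have := ua m; have := ua n.
    by rewrite -(rkN (u m - inj (a m))) opprB; lra.
  exists (limit ca) => eps eps0; have e3 : 0 < eps / 3 by lra.
  have [[N hN] [M hM]] := (ca _ e3, half_expn_small e3); exists (maxn N M) => m.
  rewrite geq_max => /andP[Nm Mm].
  have lim_m : rk (inj (a m) - limit ca) <= eps / 3.
    rewrite /inj !limitE.
    by apply: tends_le (rk_limit _) (@tends_cst _) _; exists N => n Nn; exact/ltW/hN.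
  have := rk_tri (inj (a m)) (u m) (limit ca); have := ua m; have := hM _ Mm.
  by lra.
- move=> x eps /near_approx-/(_ x)[N hN]; exists (approx x N); exact: hN.
Qed.

End Completion.

(** * The direct limit of an ultramatricial system *)

Lemma sum_shifted_delta (K : fieldType) (m o r : nat) (F : 'I_m -> K) :
  \sum_(p < m) (r == o + p)%N%:R * F p =
  if (o <= r < o + m)%N then (if insub (r - o)%N is Some p then F p else 0) else 0.
Proof.
case: ifP => [/andP[le lt]|nlt].
  case: insubP => [p _ pE|]; last by rewrite ltn_subLR // lt.
  rewrite (bigD1 p) //= big1 ?addr0 => [|q qp]; first by rewrite pE subnKC // eqxx mul1r.
  case: eqP => [rE|_]; last by rewrite mul0r.
  by case/eqP: qp; apply/val_inj; rewrite pE rE addKn.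
rewrite big1 // => p _; case: eqP => [rE|_]; last by rewrite mul0r.
by move: nlt; rewrite rE leq_addr ltn_add2l ltn_ord.
Qed.

Section Level.
Variables (K : fieldType) (i : nat -> nat) (d : nat -> nat -> nat).
Variables (Kc : nat -> nat -> nat -> nat) (P : nat -> nat -> R).

Lemma ualg_eq n (a b : ualg K i d n) : (forall l, a l = b l) -> a = b.
Proof. exact: functional_extensionality_dep. Qed.

Hypothesis d_pos : forall n l, (l < i n)%N -> (0 < d n l)%N.
Hypothesis dE : forall n j, (j < i n.+1)%N -> d n.+1 j = (\sum_(l < i n) d n l * Kc n l j)%N.
Hypothesis harm : harmonic i d Kc P.

Definition copy n (j : 'I_(i n.+1)) := {l : 'I_(i n) & 'I_(Kc n l j)}.

(* The rows of [placement x] are the coordinate vectors of the block of copy [x]. *)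
Definition placement n (j : 'I_(i n.+1)) (x : copy j) : 'M[K]_(d n (tag x), d n.+1 j) :=
  \matrix_(p, r) (r == blk_off d Kc n (tag x) (tagged x) j + p :> nat)%N%:R.

(** Block sums become sums of [J^T * a * J]; products, units and ranks then follow from the
    orthogonality relations of the placements. *)
Lemma ua_phiE n (a : ualg K i d n) (j : 'I_(i n.+1)) :
  ua_phi Kc a j = \sum_(x : copy j) (placement x)^T *m a (tag x) *m placement x.
Proof.
apply/matrixP => r s; rewrite mxE /phi_entry summxE.
rewrite (sig_big_dep _ (fun=> xpredT)) /=; apply: eq_bigr => -[l c] _ /=.
set o := blk_off _ _ _ _ _ _.
rewrite mxE (eq_bigr (fun q : 'I_(d n l) => (s == o + q :> nat)%N%:R *
    (\sum_(p < d n l) (r == o + p :> nat)%N%:R * a l p q))); last first.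
  move=> q _; rewrite !mxE mulrC; congr (_ * _).
  by apply: eq_bigr => p _; rewrite !mxE.
rewrite sum_shifted_delta; have [sP|sP] := boolP (o <= s < o + d n l)%N; last by rewrite andbF.
rewrite andbT /mxget; case: (insub (s - o)%N) => [q|]; last by case: ifP => // _; case: insub.
by rewrite sum_shifted_delta; case: ifP.
Qed.

Lemma copy_lt n (j : 'I_(i n.+1)) (x : copy j) (p : 'I_(d n (tag x))) :
  (blk_off d Kc n (tag x) (tagged x) j + p < d n.+1 j)%N.
Proof.
rewrite dE //; apply: (@boff_lt (d n) (fun l => Kc n l j)) => //; exact: (ltn_ord (tagged x)).
Qed.

Lemma placement_tr n (j : 'I_(i n.+1)) (x y : copy j) p q :
  (placement x *m (placement y)^T) p q =
  (blk_off d Kc n (tag x) (tagged x) j + p == blk_off d Kc n (tag y) (tagged y) j + q)%N%:R.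
Proof.
rewrite mxE; under eq_bigr do rewrite !mxE.
rewrite (bigD1 (Ordinal (copy_lt p))) //= eqxx mul1r big1 ?addr0 // => r nr.
by case: eqP => [rE|_]; rewrite ?mul0r //; case/eqP: nr; apply: val_inj.
Qed.

Lemma placement_same n (j : 'I_(i n.+1)) (x : copy j) : placement x *m (placement x)^T = 1%:M.
Proof. by apply/matrixP => p q; rewrite placement_tr mxE eqn_add2l. Qed.

Lemma placement_diff n (j : 'I_(i n.+1)) (x y : copy j) :
  x != y -> placement x *m (placement y)^T = 0.
Proof.
move=> /eqP nxy; apply/matrixP => p q; rewrite placement_tr mxE; case: eqP => // eo.
case: nxy; case: x y p q eo => [l c] [l' c'] /= p q.
case/(@boff_inj (d n) (fun l => Kc n l j)) => //; try exact: ltn_ord.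
by move/val_inj => ll; subst l' => /val_inj-> _.
Qed.

(** By the dimension formula no coordinate lies outside the blocks; this makes [ua_phi] unital. *)
Lemma placement_sum n (j : 'I_(i n.+1)) :
  \sum_(x : copy j) (placement x)^T *m placement x = 1%:M.
Proof.
apply/matrixP => r s; rewrite summxE mxE.
have := ltn_ord r; rewrite [X in (_ < X)%N -> _](_ : _ = \sum_(l < i n) d n l * Kc n l j)%N; last first.
  exact: dE.
case/(@boff_decode (d n) (fun l => Kc n l j)) => l [c [p [li cK pd rE]]].
have entry (x : copy j) : ((placement x)^T *m placement x) r s =
    \sum_(q < d n (tag x)) (r == blk_off d Kc n (tag x) (tagged x) j + q :> nat)%N%:R * (r == s)%:R.
  rewrite mxE; apply: eq_bigr => q _; rewrite !mxE.
  case: eqP => [rq|_]; last by rewrite !mul0r.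
  by rewrite -val_eqE /= rq eq_sym.
pose x : copy j := existT _ (Ordinal li) (Ordinal cK).
have rx (y : copy j) (q : 'I_(d n (tag y))) :
    nat_of_ord r = (blk_off d Kc n (tag y) (tagged y) j + q)%N -> x = y /\ p = q.
  rewrite rE; case: y q => [l' c'] /= q.
  case/(@boff_inj (d n) (fun l => Kc n l j)) => //; try exact: ltn_ord.
  move=> ll cc pq; split=> //; rewrite /x; have ll' : Ordinal li = l' by apply: val_inj.
  by subst l'; congr existT; apply: val_inj.
under eq_bigr do rewrite entry.
rewrite (bigD1 x) //= [X in _ + X]big1 ?addr0 => [|y yx].
  rewrite (bigD1 (Ordinal (pd : (p < d n (tag x))%N))) //= big1 ?addr0 => [|q qp].
    by rewrite rE eqxx mul1r.
  case: eqP => [/(rx x)[_ pq]|_]; last by rewrite mul0r.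
  by case/eqP: qp; apply: val_inj.
rewrite big1 // => q _; case: eqP => [/rx[xy _]|_]; last by rewrite mul0r.
by rewrite xy eqxx in yx.
Qed.

Lemma ua_phi1 n : ua_phi Kc (@ua_one K i d n) = @ua_one K i d n.+1.
Proof.
apply: ualg_eq => j; rewrite ua_phiE -[RHS]placement_sum.
by apply: eq_bigr => x _; rewrite mulmx1.
Qed.

Lemma ua_phiM n (a b : ualg K i d n) : ua_phi Kc (ua_mul a b) = ua_mul (ua_phi Kc a) (ua_phi Kc b).
Proof.
apply: ualg_eq => j; rewrite /ua_mul !ua_phiE mulmx_suml; apply: eq_bigr => x _.
rewrite mulmx_sumr (bigD1 x) //= big1 ?addr0 => [|y yx].
  by rewrite !mulmxA -[_ *m placement x *m _]mulmxA placement_same mulmx1.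
by rewrite !mulmxA -[_ *m placement x *m _]mulmxA placement_diff 1?eq_sym // mulmx0 !mul0mx.
Qed.

Lemma ua_phiD n (a b : ualg K i d n) : ua_phi Kc (ua_add a b) = ua_add (ua_phi Kc a) (ua_phi Kc b).
Proof.
apply: ualg_eq => j; rewrite /ua_add !ua_phiE -big_split; apply: eq_bigr => x _ /=.
by rewrite mulmxDr mulmxDl.
Qed.

Lemma placement_phi n (a : ualg K i d n) (j : 'I_(i n.+1)) (x : copy j) :
  placement x *m ua_phi Kc a j = a (tag x) *m placement x.
Proof.
rewrite ua_phiE mulmx_sumr (bigD1 x) //= big1 ?addr0 => [|y yx].
  by rewrite !mulmxA placement_same mul1mx.
by rewrite !mulmxA placement_diff 1?eq_sym // !mul0mx.
Qed.

Lemma ua_phi_inj n : (forall l, (l < i n)%N -> exists2 j, (j < i n.+1)%N & (0 < Kc n l j)%N) ->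
  injective (@ua_phi K i d Kc n).
Proof.
move=> Kpos a b phi_ab; apply: ualg_eq => l.
have [j ji K0] := Kpos l (ltn_ord l).
pose x : copy (Ordinal ji) := existT _ l (Ordinal K0).
have phiK (c : ualg K i d n) : c (tag x) = placement x *m ua_phi Kc c (Ordinal ji) *m (placement x)^T.
  by rewrite placement_phi -mulmxA placement_same mulmx1.
by have := phiK a; rewrite phi_ab -phiK.
Qed.

Definition ua_opp n (a : ualg K i d n) : ualg K i d n := fun l => - a l.
Definition ua_zero n : ualg K i d n := fun=> 0.

Lemma ua_phiN n (a : ualg K i d n) : ua_phi Kc (ua_opp a) = ua_opp (ua_phi Kc a).
Proof.
apply: ualg_eq => j; rewrite /ua_opp !ua_phiE -sumrN; apply: eq_bigr => x _ /=.
by rewrite mulmxN mulNmx.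
Qed.

Lemma ua_phi0 n : ua_phi Kc (@ua_zero n) = @ua_zero n.+1.
Proof.
by apply: ualg_eq => j; rewrite ua_phiE big1 // => x _; rewrite mulmx0 mul0mx.
Qed.

Let d_gt0 n (l : 'I_(i n)) : 0 < (d n l)%:R :> R.
Proof. by rewrite ltr0n d_pos. Qed.

Let P_ge0 n (l : 'I_(i n)) : 0 <= P n l.
Proof. by case: harm => /(_ n l (ltn_ord l)). Qed.

Lemma ua_rank_phi n (a : ualg K i d n) : ua_rank P (ua_phi Kc a) = ua_rank P a.
Proof.
have rkE (j : 'I_(i n.+1)) : (\rank (ua_phi Kc a j))%:R =
    \sum_(l < i n) (Kc n l j)%:R * (\rank (a l))%:R :> R.
  rewrite ua_phiE mxrank_orth_sum; [|exact: placement_same|exact: placement_diff].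
  transitivity (\sum_(l < i n) \sum_(c < Kc n l j) (\rank (a l))%:R : R).
    by rewrite (sig_big_dep _ (fun=> xpredT)) /= natr_sum.
  by apply: eq_bigr => l _; rewrite sumr_const card_ord mulr_natl.
rewrite /ua_rank; under eq_bigr do rewrite rkE mulr_sumr mulr_suml.
rewrite exchange_big /=; apply: eq_bigr => l _.
case: harm => _ _ /(_ n l (ltn_ord l)) ->; rewrite !mulr_suml; apply: eq_bigr => j _.
by rewrite natrM; field; rewrite !lt0r_neq0.
Qed.

Lemma ua_rank_ge0 n (a : ualg K i d n) : 0 <= ua_rank P a.
Proof. by apply: sumr_ge0 => l _; rewrite divr_ge0 ?mulr_ge0 ?ler0n. Qed.

Lemma ua_rank_le n (a b : ualg K i d n) :
  (forall l, (\rank (a l) <= \rank (b l))%N) -> ua_rank P a <= ua_rank P b.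
Proof.
move=> ab; apply: ler_sum => l _; rewrite ler_wpM2r ?invr_ge0 ?ler0n //.
by rewrite ler_wpM2l // ler_nat.
Qed.

Lemma ua_rank0 n : ua_rank P (@ua_zero n) = 0.
Proof. by rewrite /ua_rank big1 // => l _; rewrite mxrank0 mulr0 mul0r. Qed.

Lemma ua_rank1 n : ua_rank P (@ua_one K i d n) = 1.
Proof.
case: harm => _ /(_ n) <- _; apply: eq_bigr => l _.
by rewrite mxrank1 mulfK // lt0r_neq0.
Qed.

Lemma ua_rankN n (a : ualg K i d n) : ua_rank P (ua_opp a) = ua_rank P a.
Proof. by apply: eq_bigr => l _; rewrite mxrank_opp. Qed.

Lemma ua_rankD n (a b : ualg K i d n) : ua_rank P (ua_add a b) <= ua_rank P a + ua_rank P b.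
Proof.
rewrite -big_split; apply: ler_sum => l _ /=.
by rewrite -mulrDl -mulrDr -natrD ler_wpM2r ?invr_ge0 ?ler0n // ler_wpM2l // ler_nat mxrank_add.
Qed.

Lemma ua_rank_almost_orth n (a b : ualg K i d n) (s := ua_add a b) :
  ua_rank P a + ua_rank P b <= ua_rank P s
    + ua_rank P (ua_add a (ua_opp (ua_mul (ua_mul a s) a)))
    + ua_rank P (ua_mul (ua_mul a s) b) + ua_rank P (ua_mul (ua_mul b s) a)
    + ua_rank P (ua_add b (ua_opp (ua_mul (ua_mul b s) b))).
Proof.
rewrite -!big_split; apply: ler_sum => l _ /=.
rewrite -!mulrDl -!mulrDr -!natrD ler_wpM2r ?invr_ge0 ?ler0n // ler_wpM2l // ler_nat.
exact: mxrank_almost_orth.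
Qed.

End Level.

(** * The algebra of eventually coherent sequences *)

Section LimitAlgebra.
Variables (K : fieldType) (i : nat -> nat) (d : nat -> nat -> nat).
Variables (Kc : nat -> nat -> nat -> nat) (P : nat -> nat -> R).
Hypothesis data : ultramatricial_data K i d Kc.
Hypothesis harm : harmonic i d Kc P.

Let d_pos n l : (l < i n)%N -> (0 < d n l)%N. Proof. by case: data => /(_ n l). Qed.
Let dE n j : (j < i n.+1)%N -> d n.+1 j = (\sum_(l < i n) d n l * Kc n l j)%N.
Proof. by case: data => _ /(_ n j). Qed.

(* The direct limit, before identifying sequences that agree from some level on. *)
Record limalg := Limalg {
  level : forall n, ualg K i d n;
  _ : exists N, forall m, (N <= m)%N -> @level m.+1 = ua_phi Kc (@level m) }.

Arguments level : clear implicits.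

Let limalg_eq (x y : limalg) : (forall n l, level x n l = level y n l) -> x = y.
Proof.
case: x y => [u hu] [v hv] /= uv.
have uv' : u = v by apply: functional_extensionality_dep => n; exact: ualg_eq (uv n).
by subst v; congr Limalg; exact: Prop_irrelevance.
Qed.

Let stable (x : limalg) : exists N, forall m, (N <= m)%N -> level x m.+1 = ua_phi Kc (level x m).
Proof. by case: x. Qed.

Let stable2 (op : forall n, ualg K i d n -> ualg K i d n -> ualg K i d n) (x y : limalg) :
    (forall n (a b : ualg K i d n), ua_phi Kc (op n a b) = op n.+1 (ua_phi Kc a) (ua_phi Kc b)) ->
  exists N, forall m, (N <= m)%N ->
    op m.+1 (level x m.+1) (level y m.+1) = ua_phi Kc (op m (level x m) (level y m)).
Proof.
move=> op_phi; have [[N hN] [M hM]] := (stable x, stable y).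
by exists (maxn N M) => m; rewrite geq_max => /andP[/hN-> /hM->].
Qed.

Let zero : limalg.
Proof. by exists (fun n => @ua_zero K i d n); exists 0%N => m _; rewrite ua_phi0. Defined.
Let one : limalg.
Proof. by exists (fun n => @ua_one K i d n); exists 0%N => m _; rewrite (ua_phi1 K dE). Defined.
Let opp (x : limalg) : limalg.
Proof.
exists (fun n => ua_opp (level x n)).
by have [N hN] := stable x; exists N => m /hN->; rewrite ua_phiN.
Defined.
Let add (x y : limalg) : limalg := Limalg (stable2 x y (@ua_phiD K i d Kc)).
Let mul (x y : limalg) : limalg := Limalg (stable2 x y (@ua_phiM K i d Kc dE)).

HB.instance Definition _ := gen_eqMixin limalg.
HB.instance Definition _ := gen_choiceMixin limalg.

Let addA : associative add.
Proof. by move=> x y z; apply: limalg_eq => n l; exact: addrA. Qed.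
Let addC : commutative add.
Proof. by move=> x y; apply: limalg_eq => n l; exact: addrC. Qed.
Let add0 : left_id zero add.
Proof. by move=> x; apply: limalg_eq => n l; exact: add0r. Qed.
Let addN : left_inverse zero opp add.
Proof. by move=> x; apply: limalg_eq => n l; exact: addNr. Qed.

HB.instance Definition _ := GRing.isZmodule.Build limalg addA addC add0 addN.

Let mulA : associative mul.
Proof. by move=> x y z; apply: limalg_eq => n l; exact: mulmxA. Qed.
Let mul1 : left_id one mul.
Proof. by move=> x; apply: limalg_eq => n l; exact: mul1mx. Qed.
Let mulx1 : right_id one mul.
Proof. by move=> x; apply: limalg_eq => n l; exact: mulmx1. Qed.
Let mulDl : left_distributive mul +%R.
Proof. by move=> x y z; apply: limalg_eq => n l; exact: mulmxDl. Qed.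
Let mulDr : right_distributive mul +%R.
Proof. by move=> x y z; apply: limalg_eq => n l; exact: mulmxDr. Qed.

HB.instance Definition _ :=
  GRing.Zmodule_isPzRing.Build limalg mulA mul1 mulx1 mulDl mulDr.

(** From the level on where [x] is coherent, harmonicity keeps the rank constant. Sequences that
    eventually agree differ by an element of rank 0, so the completion identifies them. *)
Let rho (x : limalg) : R := ua_rank P (level x (sval (cid (stable x)))).

Let rho_const (x : limalg) N : (forall m, (N <= m)%N -> level x m.+1 = ua_phi Kc (level x m)) ->
  forall m, (N <= m)%N -> ua_rank P (level x m) = ua_rank P (level x N).
Proof.
move=> st m /subnK <-; elim: (m - N)%N => // k IHk.
by rewrite addSn st ?leq_addl // (ua_rank_phi d_pos dE harm).
Qed.

Let rhoE (x : limalg) : exists N, forall m, (N <= m)%N -> rho x = ua_rank P (level x m).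
Proof.
exists (sval (cid (stable x))) => m le; symmetry.
exact: rho_const (svalP (cid (stable x))) _ le.
Qed.

Let rho_all (s : seq limalg) : exists m, forall x, x \in s -> rho x = ua_rank P (level x m).
Proof.
suff [N hN] : exists N, forall m, (N <= m)%N -> forall x, x \in s -> rho x = ua_rank P (level x m).
  by exists N; exact: hN.
elim: s => [|x s [N hN]]; first by exists 0%N.
have [M hM] := rhoE x; exists (maxn N M) => m; rewrite geq_max => /andP[Nm Mm] y.
by rewrite inE => /predU1P[->|ys]; [exact: hM|exact: hN].
Qed.

Let rho_pr : pseudo_rank rho.
Proof.
split.
- by split; [rewrite /rho /= ua_rank0|rewrite /rho /= (ua_rank1 K d_pos harm)].
- by move=> x; apply: (ua_rank_ge0 harm).
- move=> x y; have [m h] := rho_all [:: x; y; x + y; - x].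
  rewrite !h ?inE ?eqxx ?orbT //; split; first exact: (ua_rankD harm).
  exact: ua_rankN.
- move=> x y; have [m h] := rho_all [:: x; y; x * y].
  rewrite !h ?inE ?eqxx ?orbT //; split; apply: (ua_rank_le harm) => l.
    exact: mxrankM_maxl.
  exact: mxrankM_maxr.
- move=> x y; pose s := x + y; have [m h] := rho_all [:: x; y; s; x - x * s * x; x * s * y; y * s * x; y - y * s * y].
  rewrite /= -/s !h ?inE ?eqxx ?orbT //; exact: (ua_rank_almost_orth harm).
Qed.

Let cast n m (a : ualg K i d n) : ualg K i d m :=
  if n =P m is ReflectT e then eq_rect n (ualg K i d) a m e else @ua_zero K i d m.

Let cast_id n (a : ualg K i d n) : @cast n n a = a.
Proof. by rewrite /cast; case: eqP => // e; rewrite (eq_irrelevance e erefl). Qed.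

(** Zero below level [n], [a] at level [n], and its images under [ua_phi] above. *)
Let extend n (a : ualg K i d n) := fix extend m : ualg K i d m :=
  if m is k.+1 then if n == k.+1 then @cast n k.+1 a else ua_phi Kc (extend k) else @cast n 0 a.

Let extend_id n (a : ualg K i d n) : @extend n a n = a.
Proof. by case: n a => [|n] a /=; rewrite ?eqxx; exact: cast_id. Qed.

Let extendS n (a : ualg K i d n) m : (n <= m)%N -> @extend n a m.+1 = ua_phi Kc (@extend n a m).
Proof. by rewrite -ltnS /= => lt; rewrite ltn_eqF. Qed.

Let emb n (a : ualg K i d n) : limalg := Limalg (ex_intro _ n (@extendS n a)).

Let rho_eq0 n (x : limalg) :
  (forall m, (n <= m)%N -> level x m.+1 = ua_phi Kc (level x m)) ->
  level x n = @ua_zero K i d n -> rho x = 0.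
Proof.
move=> st x0; have [N hN] := rhoE x.
rewrite (hN (maxn N n)) ?leq_maxl // (rho_const st) ?leq_maxr //.
by rewrite x0 ua_rank0.
Qed.

Let rho_emb n (a : ualg K i d n) : rho (emb a) = ua_rank P a.
Proof.
have [N hN] := rhoE (emb a); rewrite (hN (maxn N n)) ?leq_maxl //.
by rewrite (@rho_const (emb a) n (@extendS n a)) ?leq_maxr //= extend_id.
Qed.

Theorem rank_completion_exists :
  exists (Rb : nzRingType) (rk : Rb -> R) (iota : forall n, ualg K i d n -> Rb),
    is_rank_completion Kc P rk iota.
Proof.
have [Rb [rk [j [rkP [j1 jD jN jM] rkj compl dense]]]] := completion_exists rho_pr.
have rk0 x : rk x = 0 -> x = 0.
  move=> rx; apply/eqP/contraT => nx; case: rkP => _ _ _ /(_ x nx).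
  by rewrite rx ltxx.
(* Two sequences coherent from level [n] on and equal there have the same image; every identity
   between the canonical maps reduces to this. *)
have j_eq n (x y : limalg) : level x n = level y n ->
    (forall m, (n <= m)%N -> level x m.+1 = ua_phi Kc (level x m)) ->
    (forall m, (n <= m)%N -> level y m.+1 = ua_phi Kc (level y m)) -> j x = j y.
  move=> xy stx sty; apply/eqP; rewrite -subr_eq0; apply/eqP/rk0.
  rewrite -jN -jD rkj; apply: (@rho_eq0 n) => [m nm|].
    by rewrite /= stx // sty // -ua_phiN -ua_phiD.
  by apply: ualg_eq => l; rewrite /= xy; exact: subrr.
have embn n (a : ualg K i d n) : level (emb a) n = a by exact: extend_id.
have embS n (a : ualg K i d n) m : (n <= m)%N -> level (emb a) m.+1 = ua_phi Kc (level (emb a) m).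
  exact: extendS.
have levelD x y m : level (x + y) m = ua_add (level x m) (level y m) by [].
have levelM x y m : level (x * y) m = ua_mul (level x m) (level y m) by [].
have level1 m : level 1 m = @ua_one K i d m by [].
exists Rb, rk, (fun n a => j (emb a)); split=> //; split=> //.
- move=> n a b; split; [rewrite -jD|rewrite -jM|rewrite -[RHS]j1]; apply: (@j_eq n);
    try (by move=> m; exact: embS); rewrite ?levelD ?levelM ?level1 ?embn // => m nm.
  + by rewrite !levelD !embS // ua_phiD.
  + by rewrite !levelM !embS // (ua_phiM dE).
  + by rewrite !level1 (ua_phi1 K dE).
- move=> n a; apply: (@j_eq n.+1) => [|m nm|m nm]; first by rewrite [RHS]embS // !embn.
    exact: embS.
  by apply: embS; exact: ltnW.
- by move=> n a; rewrite rkj rho_emb.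
- move=> x eps /(dense x)[y xy]; have [N hN] := stable y.
  exists N, (level y N); rewrite (_ : j (emb (level y N)) = j y) //.
  by apply: (@j_eq N) => [|m|//]; [exact: embn|exact: embS].
Qed.

End LimitAlgebra.

(** * The group algebra and the tower of tilings *)

Lemma sum_reindex_supp (V : nmodType) (T1 T2 : eqType) (r : seq T1) (s : seq T2)
    (h : T1 -> T2) (F : T2 -> V) :
    uniq r -> uniq s -> {in r &, injective h} ->
    (forall t, t \in r -> h t \notin s -> F (h t) = 0) ->
    (forall k, k \in s -> F k != 0 -> exists2 t, t \in r & h t = k) ->
  \sum_(t <- r) F (h t) = \sum_(k <- s) F k.
Proof.
move=> ur us hinj out ex.
have nz (q : seq T2) : \sum_(k <- q) F k = \sum_(k <- [seq k <- q | F k != 0]) F k.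
  rewrite big_filter [RHS]big_mkcond; apply: eq_bigr => k _.
  by case: eqP.
rewrite -(big_map h xpredT) (nz [seq h t | t <- r]) (nz s); apply: perm_big; apply: uniq_perm.
- by rewrite filter_uniq // map_inj_in_uniq.
- exact: filter_uniq.
move=> k; rewrite !mem_filter; apply: andb_id2l => Fk.
apply/mapP/idP => [[t tr kE]|/ex/(_ Fk)[t tr <-]]; last by exists t.
by apply/contraT => ks; move: Fk; rewrite kE out ?eqxx // -kE.
Qed.

Section GroupAlgebra.
Variables (G : groupType) (K : fieldType).
Implicit Types x y : galg G K.

Lemma galg_addE x y g : galg_add x y g = x g + y g.
Proof.
rewrite /galg_add fsfunE; case: ifP => //; rewrite inE !mem_finsupp.
by do 2 case: eqP => //= ->; rewrite addr0.
Qed.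

Lemma galg_oneE g : galg_one G K g = (g == 1%g)%:R.
Proof. by rewrite /galg_one fsfunE inE; case: eqP. Qed.

(** Summation over the support of the right factor matches the matrix product, where column [z] is
    first moved by the support of [y]. *)
Lemma galg_mulE x y g : galg_mul x y g = \sum_(k <- finsupp y) x (g * k^-1)%g * y k.
Proof.
have -> : galg_mul x y g = \sum_(h <- finsupp x) x h * y (h^-1 * g)%g.
  rewrite /galg_mul fsfunE; case: ifP => // /negbT ng; rewrite big_seq big1 // => h hx.
  have [hy|hy] := boolP ((h^-1 * g)%g \in finsupp y); last by rewrite (fsfun_dflt hy) mulr0.
  by case/negP: ng; apply/imfset2P; exists h => //; exists (h^-1 * g)%g; rewrite ?mulKVg.
rewrite -(@sum_reindex_supp _ _ _ (finsupp x) (finsupp y) (fun h => h^-1 * g)%g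
           (fun k => x (g * k^-1)%g * y k)) ?fset_uniq //.
- by apply: eq_bigr => h _; rewrite invMg invgK mulKVg.
- by move=> h h' _ _ /mulIg/invg_inj.
- by move=> h _ /fsfun_dflt ->; rewrite mulr0.
- move=> k _; rewrite mulf_eq0 negb_or => /andP[nx _]; exists (g * k^-1)%g.
    by rewrite mem_finsupp.
  by rewrite invMg invgK mulgVK.
Qed.

End GroupAlgebra.

(** * Means of positions in a tiling *)

Section TilingMeasure.
Variables (G : groupType) (mu : (G -> Prop) -> R) (t : tiling G).
Hypotheses (mu_mean : invariant_mean mu) (tP : tiling_spec t).

Lemma tile_point x p : (p < siz t (typ t x))%N ->
  let y := (shp t (typ t x) p * org t x)%g in
  [/\ typ t y = typ t x, org t y = org t x & pos t y = p].
Proof.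
case: tP => _ _ _ ttyp tpos /tpos[oy py]; split=> //; exact: ttyp.
Qed.

Lemma tile_eq x y : org t x = org t y -> pos t x = pos t y -> x = y.
Proof.
case: tP => _ _ tE ttyp _ oxy pxy.
by rewrite (tE x) (tE y) oxy pxy (ttyp _ _ oxy).
Qed.

(** Left translation by [shp p * (shp q)^-1] carries the points at position [q] onto those at
    position [p]. *)
Lemma mean_position l p : (p < siz t l)%N ->
  mu (fun x => typ t x = l /\ pos t x = p) = mu (fun x => typ t x = l) / (siz t l)%:R.
Proof.
case: (tP) => tlt _ tE _ _ pl.
have shift q : (q < siz t l)%N ->
    mu (fun x => typ t x = l /\ pos t x = q) = mu (fun x => typ t x = l /\ pos t x = p).
  move=> ql; rewrite -[RHS](mean_translate mu_mean (shp t l p * (shp t l q)^-1)%g).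
  apply: mean_ext => x; split=> /= -[tx px].
    rewrite [x in (_ * x)%g]tE tx px -mulgA mulKg -tx.
    by have := @tile_point x p; rewrite tx => /(_ pl)[-> _ ->].
  set y := (_ * x)%g in tx px.
  have -> : x = (shp t (typ t y) q * org t y)%g.
    apply: (mulgI (shp t l p * (shp t l q)^-1)%g); rewrite -/y -mulgA tx mulKg.
    by rewrite {1}(tE y) tx px.
  by have := @tile_point y q; rewrite tx => /(_ ql)[-> _ ->].
rewrite [X in X / _](@mean_sum_disjoint _ _ mu_mean _
    (fun (q : 'I_(siz t l)) x => typ t x = l /\ pos t x = q)).
- under eq_bigr => q _ do rewrite shift //.
  rewrite sumr_const card_ord -(mulr_natr (mu _)) mulfK // pnatr_eq0 -lt0n.
  exact: leq_ltn_trans pl.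
- move=> x; split=> [tx|[q []] //]; have [_ px] := tlt x; rewrite tx in px.
  by exists (Ordinal px).
- by move=> q q' x [_ xq] [_ xq']; apply: val_inj; rewrite /= -xq -xq'.
Qed.

(** The right-hand side has the form of [ua_rank], with numbers of columns in place of ranks. *)
Lemma mean_positions (Q : forall l : 'I_(num t), 'I_(siz t l) -> bool) :
  mu (fun x => exists (l : 'I_(num t)) (s : 'I_(siz t l)),
                 [/\ typ t x = l, pos t x = s & Q l s]) =
  \sum_(l < num t) mu (fun x => typ t x = l) * #|[set s | Q l s]|%:R / (siz t l)%:R.
Proof.
rewrite (@mean_sum_disjoint _ _ mu_mean _
   (fun (v : {l : 'I_(num t) & 'I_(siz t l)}) x =>
      [/\ typ t x = tag v, pos t x = tagged v & Q (tag v) (tagged v)])).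
- transitivity (\sum_(l < num t) \sum_(s < siz t l)
      mu (fun x => [/\ typ t x = l, pos t x = s & Q l s])).
    by rewrite (sig_big_dep _ (fun=> xpredT)).
  apply: eq_bigr => l _; rewrite -sum1_card natr_sum mulr_sumr mulr_suml [RHS]big_mkcond /=.
  apply: eq_bigr => s _; rewrite inE; case: ifP => Qs.
    by rewrite mulr1 -(mean_position (ltn_ord s)); apply: mean_ext => x; split=> [[]|[]].
  by apply: mean_set0 => // x [].
- move=> x; split=> [[l [s h]]|[[l s] h]]; first by exists (existT _ l s).
  by exists l, s.
- move=> [l s] [l' s'] x /= [tl ps _] [tl' ps' _].
  have ll : l = l' by apply: val_inj; rewrite /= -tl -tl'.
  by subst l'; congr existT; apply: val_inj; rewrite /= -ps -ps'.
Qed.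

End TilingMeasure.

(** * One refinement step and its block diagonal embedding *)

Section Refinement.
Variables (G : groupType) (t t' : tiling G) (M : nat -> nat -> nat).
Hypotheses (tP : tiling_spec t) (t'P : tiling_spec t') (ref : refines t t' M).

Let off j l c := boff (siz t) (M^~ j) l c.

Lemma refines_lt j l c p : (j < num t')%N -> (l < num t)%N -> (c < M l j)%N ->
  (p < siz t l)%N -> (off j l c + p < siz t' j)%N.
Proof.
case: ref => sizE _ _ jn ln cM ps; rewrite sizE //.
exact: (@boff_lt (siz t) (M^~ j)).
Qed.

(** Uniqueness of addresses: inside a coarse tile, the block of rows around [z] consists precisely
    of the fine tile of [z]. *)
Lemma refines_pos w z : org t' w = org t' z -> exists2 c : nat, (c < M (typ t z) (typ t' z))%N &
  pos t' z = (off (typ t' z) (typ t z) c + pos t z)%N /\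
  forall q, (q < siz t (typ t z))%N -> pos t' w = (off (typ t' z) (typ t z) c + q)%N <->
    org t w = org t z /\ pos t w = q.
Proof.
have [tlt _ _ ttyp _] := tP; have [_ _ _ ttyp' _] := t'P.
move=> owz; case: ref => _ rorg [cop copP].
have [copz cz pz] := copP z; have [_ cw pw] := copP w.
exists (cop z) => //; split=> // q qs.
have tt' := ttyp' _ _ owz.
split=> [wq|[ow <-]]; last by rewrite pw tt' (ttyp _ _ ow) (copz w).
rewrite pw tt' in wq; rewrite tt' in cw; have [_ pws] := tlt w.
have [tw cE pq] := @boff_inj (siz t) (M^~ (typ t' z)) _ _ _ _ _ _ cw pws cz qs wq.
rewrite tw in pws; have /= [ty oy py] := tile_point tP pws.
set y := (_ * _)%g in ty oy py.
have [copy_ _ py'] := copP y; have oy' := rorg _ _ oy.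
suff wy : w = y by rewrite {1}wy oy pq.
apply: (tile_eq t'P); first by rewrite oy'.
by rewrite pw py' tt' (ttyp' _ _ oy') ty py tw cE (copy_ z).
Qed.

Lemma refines_child l : (l < num t)%N -> exists2 j, (j < num t')%N & (0 < M l j)%N.
Proof.
have [_ tex _ _ _] := tP; have [tlt' _ _ _ _] := t'P.
move=> /tex[x <-]; have [c cM _] := @refines_pos x x erefl.
by exists (typ t' x); [case: (tlt' x)|exact: leq_ltn_trans cM].
Qed.

Variables (mu : (G -> Prop) -> R).
Hypothesis mu_mean : invariant_mean mu.

(** Among the [siz t' j] positions of a coarse shape, which have equal mean, [siz t l * M l j] lie
    in fine tiles of type [l]. *)
Lemma refines_harmonic l : (l < num t)%N ->
  mu (fun x => typ t x = l) =
  \sum_(j < num t') (siz t l * M l j)%:R / (siz t' j)%:R * mu (fun x => typ t' x = j).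
Proof.
move=> ln; have [tlt _ tE _ _] := tP; have [tlt' _ tE' _ _] := t'P.
pose Q (j : 'I_(num t')) (r : 'I_(siz t' j)) :=
  [exists c : 'I_(M l j), exists p : 'I_(siz t l), r == off j l c + p :> nat]%N.
have cardQ j : #|[set r | Q j r]| = (siz t l * M l j)%N.
  pose h (v : 'I_(M l j) * 'I_(siz t l)) :=
    Ordinal (refines_lt (ltn_ord j) ln (ltn_ord v.1) (ltn_ord v.2)).
  have hinj : injective h.
    move=> [c p] [c' p'] /(congr1 val) /= eqo.
    have [] := @boff_inj (siz t) (M^~ j) l c p l c' p' _ _ _ _ eqo; rewrite ?ltn_ord //.
    by move=> _ /val_inj-> /val_inj->.
  transitivity #|[set h v | v in [set: 'I_(M l j) * 'I_(siz t l)]]|.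
    apply: eq_card => r; rewrite inE; apply/existsP/imsetP => [[c /existsP[p /eqP rE]]|[[c p] _ ->]].
      by exists (c, p); rewrite ?inE //; apply: val_inj.
    by exists c; apply/existsP; exists p.
  by rewrite card_imset // cardsT card_prod !card_ord mulnC.
transitivity (mu (fun x => exists (j : 'I_(num t')) (r : 'I_(siz t' j)),
                    [/\ typ t' x = j, pos t' x = r & Q j r])).
  apply: mean_ext => x; have [c cM [px pP]] := @refines_pos x x erefl.
  have [lx sx] := tlt x; have [jx rx] := tlt' x; split=> [xl|].
    subst l; exists (Ordinal jx), (Ordinal rx); split=> //.
    by apply/existsP; exists (Ordinal cM); apply/existsP; exists (Ordinal sx); rewrite /= px.
  case=> j [r [xj xr /existsP[c' /existsP[p /eqP rE]]]].
  rewrite -xr px xj in rE; rewrite xj in cM.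
  by have [] := @boff_inj (siz t) (M^~ j) _ _ _ _ _ _ cM sx (ltn_ord c') (ltn_ord p) rE.
rewrite (mean_positions mu_mean t'P); apply: eq_bigr => j _.
by rewrite cardQ -mulrA [LHS]mulrC.
Qed.

(** The column of [z] meets a single block of the double sum, that of the fine tile of [z]. *)
Lemma phi_entry_refines (K : fieldType) (i : nat -> nat) (d : nat -> nat -> nat)
    (Kc : nat -> nat -> nat -> nat) (n : nat) (a : ualg K i d n) (l : 'I_(i n)) w z :
    i n = num t -> d n =1 siz t -> Kc n =2 M -> typ t z = l -> org t' w = org t' z ->
  phi_entry Kc a (typ t' z) (pos t' w) (pos t' z) =
  if org t w == org t z then mxget (a l) (pos t w) (pos t z) else 0.
Proof.
move=> iE /funext dE KE tz owz.
have {}KE : Kc n = M by apply/funext => u; apply/funext => v; exact: KE.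
have [tlt _ _ _ _] := tP.
have [c cM [pz pw]] := refines_pos owz; have [_ sz] := tlt z.
have offE l' c' : blk_off d Kc n l' c' (typ t' z) = off (typ t' z) l' c'.
  by rewrite /blk_off dE KE.
have blockz l' c' : (c' < Kc n l' (typ t' z))%N ->
    (blk_off d Kc n l' c' (typ t' z) <= pos t' z < blk_off d Kc n l' c' (typ t' z) + d n l')%N ->
    l' = typ t z /\ c' = c.
  rewrite offE dE KE => c'M /andP[le lt].
  have [] := @boff_inj (siz t) (M^~ (typ t' z)) l' c'
    (pos t' z - off (typ t' z) l' c') (typ t z) c (pos t z) => //.
  - by rewrite ltn_subLR.
  - by rewrite -pz subnKC.
rewrite /phi_entry (bigD1 l) //= [X in _ + X]big1 ?addr0 => [|l' l'l]; last first.
  apply: big1 => c' _; case: ifP => // /andP[_ /blockz[|ll _]]; first exact: ltn_ord.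
  by case/eqP: l'l; apply: val_inj; rewrite /= ll tz.
rewrite -KE tz in cM; rewrite (bigD1 (Ordinal cM)) //= big1 ?addr0 => [|c' c'c]; last first.
  case: ifP => // /andP[_ /blockz[|_ cc]]; first exact: ltn_ord.
  by case/eqP: c'c; apply: val_inj.
have oE : blk_off d Kc n l c (typ t' z) = off (typ t' z) (typ t z) c by rewrite offE tz.
have dlE : d n l = siz t (typ t z) by rewrite dE tz.
have pzE : (pos t' z - blk_off d Kc n l c (typ t' z) = pos t z)%N by rewrite pz oE addKn.
have zin : (blk_off d Kc n l c (typ t' z) <= pos t' z < blk_off d Kc n l c (typ t' z) + d n l)%N.
  by rewrite oE dlE pz leq_addr ltn_add2l.
rewrite zin andbT pzE; case: eqP => [ow|now].
  have [_ _ _ ttyp _] := tP; have pws : (pos t w < siz t (typ t z))%N.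
    by have [_] := tlt w; rewrite (ttyp _ _ ow).
  have /(pw _ pws) pwE := conj ow (erefl (pos t w)).
  by rewrite pwE -oE addKn ifT // leq_addr ltn_add2l dlE.
case: ifP => // /andP[le lt]; case: now; rewrite oE in le lt.
have qs : (pos t' w - off (typ t' z) (typ t z) c < siz t (typ t z))%N by rewrite ltn_subLR // -dlE.
by have [|] := proj1 (pw _ qs); rewrite ?subnKC.
Qed.

End Refinement.

(** * The embedding of the group algebra *)

Section Tower.
Variables (G : groupType) (K : fieldType) (e : nat -> G) (mu : (G -> Prop) -> R).
Variables (T : nat -> tiling G) (M : nat -> nat -> nat -> nat).
Hypothesis e_surj : forall g, exists n, e n = g.
Hypothesis mu_mean : invariant_mean mu.
Hypothesis tower : forall n, [/\ tiling_spec (T n), refines (T n) (T n.+1) (M n)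
  & forall k, (k < n)%N -> mu (fun x => org (T n) (e k * x)%g <> org (T n) x) < 2^-1 ^+ n].

Let i n := num (T n).
Let d n l := siz (T n) l.
Let P n l := mu (fun x => typ (T n) x = l).

Let tP n : tiling_spec (T n). Proof. by case: (tower n). Qed.
Let ref n : refines (T n) (T n.+1) (M n). Proof. by case: (tower n). Qed.

Let typ_lt n x : (typ (T n) x < i n)%N. Proof. by case: (tP n) => /(_ x)[]. Qed.
Let pos_lt n x : (pos (T n) x < d n (typ (T n) x))%N. Proof. by case: (tP n) => /(_ x)[]. Qed.

Lemma tower_data : ultramatricial_data K i d M.
Proof.
have dE n j : (j < i n.+1)%N -> d n.+1 j = (\sum_(l < i n) d n l * M n l j)%N.
  by case: (ref n) => + _ _; apply.
split=> [n l ln||n]; first by have [_ /(_ l ln)[x <-] _ _ _] := tP n; exact: leq_ltn_trans (pos_lt n x).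
  exact: dE.
by apply: ua_phi_inj => // l ln; exact: refines_child (tP n) (tP n.+1) (ref n) _ ln.
Qed.

Lemma tower_harmonic : harmonic i d M P.
Proof.
split=> [n l _|n|n l ln]; first exact: (mean_ge0 mu_mean).
  rewrite -(@mean_sum_disjoint _ _ mu_mean _ (fun (l : 'I_(i n)) x => typ (T n) x = l) (fun=> True)).
  - exact: mean_setT mu_mean.
  - by move=> x; split=> // _; exists (Ordinal (typ_lt n x)).
  - by move=> l l' x xl xl'; apply: val_inj; rewrite /= -xl -xl'.
exact: (refines_harmonic (tP n) (tP n.+1) (ref n) mu_mean ln).
Qed.

(* Left multiplication by [x], compressed to the tiles of level [n]. *)
Definition trunc n (x : galg G K) : ualg K i d n :=
  fun l => \matrix_(r, s) x (shp (T n) l r * (shp (T n) l s)^-1)%g.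

Arguments trunc : clear implicits.

Definition exits n (x : galg G K) (z : G) : Prop :=
  exists2 h, h \in finsupp x & org (T n) (h * z)%g <> org (T n) z.

Lemma exits_small (x : galg G K) : exists N, forall n, (N <= n)%N ->
  mu (exits n x) <= (size (finsupp x))%:R * 2^-1 ^+ n.
Proof.
have bound (s : seq G) : exists N, forall h, h \in s -> exists2 k, (k < N)%N & e k = h.
  elim: s => [|h s [N hN]]; first by exists 0%N.
  have [k ek] := e_surj h; exists (maxn N k.+1) => h'; rewrite inE => /predU1P[->|/hN[k' kN' ek']].
    by exists k; rewrite // leq_max leqnn orbT.
  by exists k'; rewrite // leq_max kN'.
have [N hN] := bound (finsupp x); exists N => n Nn; apply: (mean_union_le mu_mean (A := fun h z => org (T n) (h * z)%g <> org (T n) z)).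
  move=> h /hN[k kN <-]; apply: ltW; case: (tower n) => _ _; apply.
  exact: leq_trans kN Nn.
by move=> z.
Qed.

Lemma shp_pos n z : shp (T n) (typ (T n) z) (pos (T n) z) = (z * (org (T n) z)^-1)%g.
Proof. by have [_ _ /(_ z) tE _ _] := tP n; rewrite {3}tE mulgK. Qed.

(** The common origin cancels, so [trunc] shows the entries of left multiplication in every tile of
    the shape. *)
Lemma shp_quotient n l r s w z : org (T n) w = org (T n) z ->
    typ (T n) z = l -> pos (T n) w = r -> pos (T n) z = s ->
  (shp (T n) l r * (shp (T n) l s)^-1)%g = (w * z^-1)%g.
Proof.
move=> ow <- <- <-; have [_ _ _ ttyp _] := tP n.
by rewrite -{1}(ttyp _ _ ow) !shp_pos ow invMg invgK mulgA mulgVK.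
Qed.

(** The rank is at most the number of nonzero columns, and a column of type [l] has mean
    [P n l / d n l]. *)
Lemma ua_rank_le_mean n (a : ualg K i d n) (B : G -> Prop) :
    (forall (l : 'I_(i n)) (r s : 'I_(d n l)) z, typ (T n) z = l -> pos (T n) z = s -> a l r s != 0 -> B z) ->
  ua_rank P a <= mu B.
Proof.
move=> aB; apply: (@le_trans _ _ (mu (fun z => exists (l : 'I_(i n)) (s : 'I_(d n l)),
    [/\ typ (T n) z = l, pos (T n) z = s & [exists r, a l r s != 0]]))).
  rewrite (mean_positions mu_mean (tP n)); apply: ler_sum => l _.
  rewrite ler_wpM2r ?invr_ge0 ?ler0n // ler_wpM2l ?(mean_ge0 mu_mean) // ler_nat.
  exact: mxrank_le_cols.
by apply: (mean_le mu_mean) => z [l [s [zl zs /existsP[r]]]]; exact: aB.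
Qed.

Lemma trunc_add n x y : trunc n (galg_add x y) = ua_add (trunc n x) (trunc n y).
Proof. by apply: ualg_eq => l; apply/matrixP => r s; rewrite !mxE galg_addE. Qed.

Lemma shp_inj n (l : 'I_(i n)) (r s : 'I_(d n l)) : shp (T n) l r = shp (T n) l s -> r = s.
Proof.
have [_ tex _ _ _] := tP n; have [x xl] := tex l (ltn_ord l).
have := @tile_point _ _ (tP n) x; rewrite xl => tl rs.
have [_ _ rE] := tl r (ltn_ord r); have [_ _ sE] := tl s (ltn_ord s).
by apply: val_inj; rewrite /= -rE -sE rs.
Qed.

Lemma trunc_one n : trunc n (galg_one G K) = @ua_one K i d n.
Proof.
apply: ualg_eq => l; apply/matrixP => r s; rewrite !mxE galg_oneE.
congr (nat_of_bool _)%:R; apply/eqP/eqP => [h|->]; last exact: mulgV.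
by apply: (@shp_inj n l); apply: (mulIg (shp (T n) l s)^-1%g); rewrite h mulgV.
Qed.

(** If the support of [y] keeps [z] in its tile, all terms of the convolution occur in the matrix
    product, and the columns of [z] agree. *)
Lemma trunc_mul n x y :
  ua_rank P (ua_add (ua_mul (trunc n x) (trunc n y)) (ua_opp (trunc n (galg_mul x y))))
    <= mu (exits n y).
Proof.
apply: ua_rank_le_mean => l r s z zl zs; apply: contra_neqP => stay.
have {}stay k : k \in finsupp y -> org (T n) (k * z)%g = org (T n) z.
  by move=> ky; apply: contrapT => nk; apply: stay; exists k.
rewrite !mxE galg_mulE; apply/eqP; rewrite subr_eq0; apply/eqP.
pose g t := (shp (T n) l t * (shp (T n) l s)^-1)%g.
rewrite -(@sum_reindex_supp _ _ _ (index_enum 'I_(d n l)) (finsupp y) g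
  (fun k => x (g r * k^-1)%g * y k)) ?index_enum_uniq ?fset_uniq //.
- by apply: eq_bigr => t _; rewrite !mxE /g invMg invgK mulgA mulgVK.
- by move=> t t' _ _ /mulIg/shp_inj.
- by move=> t _ /fsfun_dflt->; rewrite mulr0.
move=> k ky _; have okz := stay k ky.
have [_ _ _ ttyp _] := tP n; have := pos_lt n (k * z)%g; rewrite (ttyp _ _ okz) zl => pk.
exists (Ordinal pk); first by rewrite mem_index_enum.
by rewrite /g (shp_quotient okz zl erefl zs) mulgK.
Qed.

(** [ua_phi] erases the entries between different fine tiles of a coarse tile; if such an entry of
    [trunc n.+1 x] is nonzero, [w * z^-1] lies in the support and moves [z] out of its fine tile. *)
Lemma trunc_phi n x :
  ua_rank P (ua_add (ua_phi M (trunc n x)) (ua_opp (trunc n.+1 x))) <= mu (exits n x).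
Proof.
apply: ua_rank_le_mean => j r s z zj zs; apply: contra_neqP => stay.
have := @tile_point _ _ (tP n.+1) z r; rewrite zj => /(_ (ltn_ord r)).
set w := (_ * _)%g => -[tw ow pw].
have truncE : trunc n.+1 x j r s = x (w * z^-1)%g.
  by rewrite mxE (shp_quotient ow zj pw zs).
have phiE : ua_phi M (trunc n x) j r s = phi_entry M (trunc n x) (typ (T n.+1) z) (pos (T n.+1) w) (pos (T n.+1) z).
  by rewrite mxE zj pw zs.
rewrite /ua_add /ua_opp mxE [X in _ + X]mxE truncE phiE.
rewrite (@phi_entry_refines _ _ _ _ (tP n) (tP n.+1) (ref n) K i d M n (trunc n x)
  (Ordinal (typ_lt n z))) //.
apply/eqP; rewrite subr_eq0; apply/eqP; case: eqP => [owz|nowz].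
  have [_ _ _ ttyp _] := tP n; have pwz : (pos (T n) w < d n (typ (T n) z))%N.
    by rewrite -(ttyp _ _ owz) pos_lt.
  rewrite /mxget (insubT (fun k => k < d n (typ (T n) z))%N pwz).
  rewrite (insubT (fun k => k < d n (typ (T n) z))%N (pos_lt n z)) mxE.
  by rewrite (shp_quotient owz erefl erefl erefl).
apply/esym/fsfun_dflt; apply/negP => wz; apply: stay.
by exists (w * z^-1)%g; rewrite ?mulgVK.
Qed.

Lemma card_le_finsupp (I : finType) (g : I -> G) (x : galg G K) (A : {set I}) :
  injective g -> (forall t, t \in A -> x (g t) != 0) -> (#|A| <= size (finsupp x))%N.
Proof.
move=> ginj Ax; rewrite cardE -(size_map g); apply: uniq_leq_size.
  by rewrite map_inj_uniq ?enum_uniq.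
by move=> _ /mapP[t tA ->]; rewrite mem_enum in tA; rewrite mem_finsupp Ax.
Qed.

(** A point [z] that does not exit has the entry [x h0] in its column, in the row of [h0 * z]. Along
    a row or a column the arguments of [x] are distinct, which bounds the nonzero entries. *)
Lemma trunc_rank_ge n (x : galg G K) h0 : h0 \in finsupp x ->
  1 - mu (exits n x) <= (size (finsupp x) ^ 2)%:R * ua_rank P (trunc n x).
Proof.
move=> h0x; set k := size _.
have [_ _ _ ttyp _] := tP n.
apply: (@le_trans _ _ (mu (fun z => exists (l : 'I_(i n)) (s : 'I_(d n l)),
    [/\ typ (T n) z = l, pos (T n) z = s & [exists r, trunc n x l r s != 0]]))).
  rewrite -(mean_setT mu_mean) (mean_split mu_mean (exits n x) (fun=> True)).
  rewrite (@mean_ext _ mu (fun z => True /\ exits n x z) (exits n x)); last by move=> z; split=> [[]|].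
  rewrite addrAC subrr add0r.
  apply: (mean_le mu_mean) => z [_ stay].
  have owz : org (T n) (h0 * z)%g = org (T n) z.
    by apply: contrapT => nk; apply: stay; exists h0.
  have := pos_lt n (h0 * z)%g; rewrite (ttyp _ _ owz) => pw.
  exists (Ordinal (typ_lt n z)), (Ordinal (pos_lt n z)); split=> //.
  apply/existsP; exists (Ordinal pw); rewrite mxE (shp_quotient owz erefl erefl erefl) mulgK.
  by rewrite -mem_finsupp.
rewrite (mean_positions mu_mean (tP n)) /ua_rank mulr_sumr; apply: ler_sum => l _.
rewrite !mulrA ler_wpM2r ?invr_ge0 ?ler0n // [leRHS]mulrAC mulrC ler_wpM2r ?(mean_ge0 mu_mean) //.
rewrite -natrM ler_nat -mulnn; apply: mxrank_ge_cols => [s|r].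
  apply: (@card_le_finsupp _ (fun r : 'I_(d n l) => shp (T n) l r * (shp (T n) l s)^-1)%g) => [r r'|r].
    by move/mulIg/shp_inj.
  by rewrite inE mxE.
apply: (@card_le_finsupp _ (fun s : 'I_(d n l) => shp (T n) l r * (shp (T n) l s)^-1)%g) => [s s'|s].
  by move/mulgI/invg_inj/shp_inj.
by rewrite inE mxE.
Qed.

Lemma tower_embedding (Rb : nzRingType) (rk : Rb -> R) (iota : forall n, ualg K i d n -> Rb) :
    is_rank_completion M P rk iota ->
  exists f : galg G K -> Rb,
    [/\ injective f,
        forall x y, f (galg_add x y) = f x + f y,
        forall x y, f (galg_mul x y) = f x * f y
      & f (galg_one G K) = 1].
Proof.
case=> -[rk1 rkM rkO rk_gt0 rkD] [iotaH iota_phi iota_rk compl _].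
have rk0 : rk 0 = 0 by have := rkO 0 0; rewrite !mulr0 addr0 => /(_ erefl erefl erefl erefl); lra.
have rkN x : rk (- x) = rk x.
  have le y : rk (- y) <= rk y by rewrite -mulN1r; case: (rkM (-1) y).
  by apply/le_anti; rewrite le -{1}(opprK x) le.
have rk_tri y x z : rk (x - z) <= rk (x - y) + rk (y - z).
  by have := rkD (x - y) (y - z); rewrite addrA subrK.
have rkC x y : rk (x - y) = rk (y - x) by rewrite -rkN opprB.
have rk_eq x y : (forall eps, 0 < eps -> rk (x - y) < eps) -> x = y.
  move=> h; apply/eqP/contraT; rewrite -subr_eq0 => /rk_gt0/h.
  by rewrite ltxx.
have iotaB n (a b : ualg K i d n) : iota n (ua_add a (ua_opp b)) = iota n a - iota n b.
  apply/eqP; rewrite eq_sym subr_eq; apply/eqP; have [<- _ _] := iotaH n (ua_add a (ua_opp b)) b.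
  by congr (iota n _); apply: ualg_eq => l; rewrite /ua_add /ua_opp subrK.
pose u x n := iota n (trunc n x).
pose E (x : galg G K) n : R := (size (finsupp x))%:R * 2^-1 ^+ n.
have E_ge0 x n : 0 <= E x n by rewrite mulr_ge0 ?ler0n ?exprn_ge0 ?invr_ge0.
have ES x n : E x n.+1 = E x n / 2 by rewrite /E exprSr mulrA.
have E_small x (eps : R) : 0 < eps -> exists N, forall n, (N <= n)%N -> E x n < eps.
  move=> eps0; have q0 : 0 < (size (finsupp x)).+1%:R :> R by rewrite ltr0n.
  have [N hN] := half_expn_small (divr_gt0 eps0 q0); exists N => n /hN.
  rewrite ltr_pdivlMr // -(natr1 (size (finsupp x))) mulrDr mulr1 mulrC; apply: le_lt_trans.
  by rewrite lerDl exprn_ge0 ?invr_ge0.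
have u_step x : exists N, forall n, (N <= n)%N -> rk (u x n.+1 - u x n) <= E x n.
  have [N hN] := exits_small x; exists N => n /hN; apply: le_trans.
  by rewrite rkC /u -iota_phi -iotaB iota_rk; exact: trunc_phi.
have u_dist x : exists N, forall n k, (N <= n)%N -> rk (u x (n + k)%N - u x n) <= 2 * E x n.
  have [N hN] := u_step x; exists N => n k Nn.
  (* The geometric sum of the errors in closed form, to make the induction telescope. *)
  suff : rk (u x (n + k)%N - u x n) <= 2 * E x n - 2 * E x (n + k)%N.
    by have := E_ge0 x (n + k)%N; lra.
  elim: k => [|k IHk]; first by rewrite addn0 !subrr rk0.
  have := rk_tri (u x (n + k)%N) (u x (n + k.+1)%N) (u x n).
  rewrite addnS ES; have := hN (n + k)%N (leq_trans Nn (leq_addr _ _)); lra.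
have /choice[f fP] x : exists v, forall eps : R, 0 < eps -> exists N, forall n, (N <= n)%N ->
    rk (u x n - v) < eps.
  apply: compl => eps eps0; have e4 : 0 < eps / 4 by lra.
  have [[N1 h1] [N2 h2]] := (u_dist x, E_small x _ e4); pose N := maxn N1 N2; exists N => m n Nm Nn.
  have near k : (N <= k)%N -> rk (u x k - u x N) < eps / 2.
    move=> Nk; have := h1 N (k - N)%N (leq_maxl _ _); have := h2 N (leq_maxr _ _).
    by rewrite subnKC //; lra.
  have := rk_tri (u x N) (u x m) (u x n); have := near m Nm; have := near n Nn.
  by rewrite (rkC (u x n)); lra.
have exits_lt x (eps : R) : 0 < eps -> exists N, forall n, (N <= n)%N -> mu (exits n x) < eps.
  move=> /(E_small x)[N1 h1]; have [N2 h2] := exits_small x.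
  by exists (maxn N1 N2) => n; rewrite geq_max => /andP[/h1 lt /h2 le]; exact: le_lt_trans lt.
have fD x y : f (galg_add x y) = f x + f y.
  apply: rk_eq => eps eps0; have e3 : 0 < eps / 3 by lra.
  have [[N1 h1] [N2 h2]] := (fP (galg_add x y) _ e3, fP x _ e3).
  have [N3 h3] := fP y _ e3; pose n := maxn N1 (maxn N2 N3).
  have uD : u (galg_add x y) n = u x n + u y n.
    by rewrite /u trunc_add; case: (iotaH n (trunc n x) (trunc n y)).
  have := h1 n; have := h2 n; have := h3 n; rewrite /n !leq_max !leqnn !orbT -/n uD.
  move=> /(_ isT) lty /(_ isT) ltx /(_ isT) ltxy.
  have := rk_tri (u x n + u y n) (f (galg_add x y)) (f x + f y).
  have -> : u x n + u y n - (f x + f y) = (u x n - f x) + (u y n - f y) by rewrite opprD addrACA.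
  have := rkD (u x n - f x) (u y n - f y); rewrite (rkC _ (u x n + u y n)).
  lra.
have fM x y : f (galg_mul x y) = f x * f y.
  apply: rk_eq => eps eps0; have e4 : 0 < eps / 4 by lra.
  have [[N1 h1] [N2 h2]] := (fP (galg_mul x y) _ e4, fP x _ e4).
  have [[N3 h3] [N4 h4]] := (fP y _ e4, exits_lt y _ e4).
  pose n := maxn (maxn N1 N2) (maxn N3 N4).
  have := h1 n; have := h2 n; have := h3 n; have := h4 n; rewrite /n !leq_max !leqnn !orbT -/n.
  move=> /(_ isT) lte /(_ isT) lty /(_ isT) ltx /(_ isT) ltxy.
  have mulE : rk (u x n * u y n - u (galg_mul x y) n) <= mu (exits n y).
    rewrite /u; have [_ <- _] := iotaH n (trunc n x) (trunc n y).
    by rewrite -iotaB iota_rk; exact: trunc_mul.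
  have := rk_tri (u (galg_mul x y) n) (f (galg_mul x y)) (f x * f y).
  have := rk_tri (u x n * u y n) (u (galg_mul x y) n) (f x * f y).
  have := rk_tri (f x * u y n) (u x n * u y n) (f x * f y).
  rewrite -mulrBl -mulrBr; have := rkM (u x n - f x) (u y n); have := rkM (f x) (u y n - f y).
  move=> [_ le1] [le2 _]; rewrite (rkC (f (galg_mul x y)) (u _ n)) (rkC (u (galg_mul x y) n) (u x n * u y n)).
  lra.
exists f; split=> //; last first.
  apply: rk_eq => eps /(fP (galg_one G K))[N /(_ N (leqnn N))].
  by rewrite /u trunc_one; have [_ _ ->] := iotaH N (trunc N (galg_one G K)) (trunc N (galg_one G K)); rewrite rkC.
have f0 x : f x = 0 -> forall h, h \notin finsupp x.
  move=> fx h; apply/negP => hx; pose k := size (finsupp x).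
  have k1 : 1 <= (k ^ 2)%:R :> R.
    rewrite ler1n expn_gt0 /k; apply/orP; left.
    by case: (finsupp x : {fset G}) hx => -[|g s] c.
  (* With exits of mean below 1/2, [trunc_rank_ge] forces rank above 1/(2 k^2), whereas convergence
     to 0 makes the rank smaller than that. *)
  have e0 : 0 < ((k ^ 2)%:R)^-1 / 2 :> R by rewrite divr_gt0 ?invr_gt0 ?(lt_le_trans _ k1) ?ltr01.
  have half : 0 < 2^-1 :> R by rewrite invr_gt0.
  have [[N1 h1] [N2 h2]] := (fP x _ e0, exits_lt x _ half).
  pose n := maxn N1 N2; have := h1 n (leq_maxl _ _); have := h2 n (leq_maxr _ _).
  rewrite fx subr0 /u iota_rk; have := trunc_rank_ge n hx; rewrite -/k => ge lt1 lt2.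
  have : (k ^ 2)%:R * ua_rank P (trunc n x) < 2^-1.
    rewrite mulrC -ltr_pdivlMr ?(lt_le_trans _ k1) ?ltr01 // mulrC; exact: lt2.
  by lra.
move=> x y fxy; pose z : galg G K := [fsfun g in (finsupp x `|` finsupp y)%fset => x g - y g | 0].
have zE g : z g = x g - y g.
  rewrite fsfunE; case: ifP => //; rewrite inE => /norP[/fsfun_dflt-> /fsfun_dflt->].
  by rewrite subr0.
have xE : galg_add z y = x by apply/fsfunP => g; rewrite galg_addE zE subrK.
have fz : f z = 0 by apply: (addIr (f y)); rewrite -fD xE fxy add0r.
apply/fsfunP => g; apply/eqP; rewrite -subr_eq0 -zE.
by apply/eqP/fsfun_dflt/f0.
Qed.

End Tower.

(** Words in the generators and their inverses form a countable type, and their evaluation reaches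
    every element. *)
Lemma finitely_generated_enum (G : groupType) : finitely_generated G ->
  exists e : nat -> G, forall g, exists n, e n = g.
Proof.
case=> s gen; pose letter (v : bool * nat) := if v.1 then nth 1%g s v.2 else (nth 1%g s v.2)^-1%g.
pose eval := foldr (fun v g => g * letter v)%g 1%g.
exists (fun n => if (choice.unpickle n : option (seq (bool * nat))) is Some w then eval w else 1%g) => g.
suff [w <-] : exists w, eval w = g by exists (choice.pickle w); rewrite choice.pickleK.
elim: (gen g) => [|x y _ [w <-] ys|x y _ [w <-] ys]; first by exists [::].
  by exists ((true, index y s) :: w); rewrite /= /letter /= nth_index.
by exists ((false, index y s) :: w); rewrite /= /letter /= nth_index.
Qed.

Theorem theorem2 (G : groupType) (K : fieldType) :
  finitely_generated G -> amenable G ->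
  exists (i : nat -> nat) (d : nat -> nat -> nat) (Kc : nat -> nat -> nat -> nat)
         (P : nat -> nat -> R),
    [/\ ultramatricial_data K i d Kc,
        harmonic i d Kc P
      & exists (Rb : nzRingType) (rk : Rb -> R) (iota : forall n, ualg K i d n -> Rb),
          is_rank_completion Kc P rk iota /\
          exists f : galg G K -> Rb,
            [/\ injective f,
                forall x y, f (galg_add x y) = f x + f y,
                forall x y, f (galg_mul x y) = f x * f y
              & f (galg_one G K) = 1]].
Proof.
move=> /finitely_generated_enum[e e_surj] [mu mu_mean].
have [T [M tower]] := tiling_tower e_surj mu_mean.
have data := tower_data K tower; have harm := tower_harmonic mu_mean tower.
have [Rb [rk [iota compl]]] := rank_completion_exists data harm.
exists (fun n => num (T n)), (fun n l => siz (T n) l), M, (fun n l => mu (fun x => typ (T n) x = l)).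
split=> //; exists Rb, rk, iota; split=> //.
exact: (tower_embedding e_surj mu_mean tower compl).
Qed.
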